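(* Let $L$ be a countable metric signature and let $\Omega$ be a universal weak modulus for $L$. Let $A$ and $B$ be separable $L$-structures and let $\bar v\in A^k$, $\bar w\in B^k$. Then $$r_\infty^\Omega(A\bar v,B\bar w)=\inf\{d^\Omega(f(\bar v),\bar w): f\text{ is an isomorphism }A\to B\}$$ (with $\inf\emptyset=\infty$). In particular, $r^\Omega_\infty(A,B)=0$ if $A\cong B$, and $r^\Omega_\infty(A,B)=\infty$ otherwise.
   Context: Moduli. For $n\in\mathbb N$ or $n=\mathbb N$, an $n$-ary modulus is a continuous function $\Delta:[0,\infty)^n\to[0,\infty)$ with $\Delta(0)=0$ and $\Delta(\delta)\le\Delta(\delta+\delta')\le\Delta(\delta)+\Delta(\delta')$. A weak modulus is a function $\Omega:[0,\infty)^{\mathbb N}\to[0,\infty]$ with $\Omega(0)=0$ and $\Omega(\delta)\le\Omega(\delta+\delta')\le\Omega(\delta)+\Omega(\delta')$ that is lower semicontinuous for the product topology and separately continuous in each argument; put $\Omega|_n(\delta_0,\dots,\delta_{n-1})=\Omega(\delta_0,\dots,\delta_{n-1},0,0,\dots)$. For $n$-tuples in a metric space, $d^\Omega(\bar a,\bar b)=\Omega|_n(d(a_0,b_0),\dots,d(a_{n-1},b_{n-1}))$. $\Omega$ is shift-increasing if for all $i_0<i_1<\cdots$ and all $\delta$, $\Omega(\delta)\le\Omega(\delta')$, where $\delta'_{i_p}=\delta_p$ and $\delta'_k=0$ for $k\notin\{i_0,i_1,\dots\}$. A map $f$ from a product of metric spaces $\prod_{i<n}X_i$ to a metric space respects $\Delta$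 if $d(f(x),f(y))\le\Delta((d(x_i,y_i))_{i<n})$ for all $x,y$. Signatures and structures. A metric signature $L$ is a set of function and predicate symbols; each symbol $s$ has an arity $n_s$ and an $n_s$-ary modulus $\Delta_s$, and each predicate symbol $P$ also has a compact interval $I_P\subseteq\mathbb R$ (its bound). $L$ always contains a binary predicate symbol $d$ with $\Delta_d(\delta_1,\delta_2)=\delta_1+\delta_2$ and some bound. An $L$-structure $A$ is a complete metric space with maps $F^A:A^{n_F}\to A$ respecting $\Delta_F$ and functions $P^A:A^{n_P}\to I_P$ respecting $\Delta_P$, where $d$ is interpreted as the distance. Isomorphisms are bijections preserving all symbols (including $d$). Basic formulas. Variables are $x_0,x_1,\dots$. $\Delta_{x_i}(\delta)=\delta_i$; $\Delta_{F(\bar\tau)}=\Delta_F\circ(\Delta_{\tau_i})_i$ for terms; an atomic formula $P(\bar\tau)$ has modulus $\Delta_P\circ(\Delta_{\tau_i})_i$ and bound $I_P$. A basic formula is $\phi=f(\phi_0,\dots,\phi_{m-1})$ with $\phi_i$ atomic and $f:\prod_i I_{\phi_i}\to\mathbb R$ continuous; its modulus is $\Delta_\phi=\Delta_f\circ(\Delta_{\phi_i})_i$, where $\Delta_f(\delta)=\sup\{|f(x)-f(y)|:|x_i-y_i|\le\delta_i\}$. $\phi^A$ is the interpretation of $\phi$ in $A$. Universal weak modulus for $L$: a weak modulus $\Omega$ such that (1) for every atomic formula $\phi(x_0,\dots,x_{k-1})$ there is $n$ with $\Delta_\phi(\delta_0,\dots,\delta_{k-1})\le\Omega|_n(0,\dots,0,\delta_0,\dots,\delta_{k-1})$;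 (2) for all $k\in\mathbb N$, $M>0$ there is $n$ with $M\cdot\Omega|_k(\delta_0,\dots,\delta_{k-1})\le\Omega|_n(0,\dots,0,\delta_0,\dots,\delta_{k-1})$; (3) $\Omega|_k(\delta_0,\dots,\delta_{k-1})+\Omega|_n(\gamma_0,\dots,\gamma_{n-1})\le\Omega|_{k+n}(\delta_0,\dots,\delta_{k-1},\gamma_0,\dots,\gamma_{n-1})$ for all $k,n$; (4) $\Omega$ is shift-increasing. Back-and-forth pseudo-distances $r_\alpha=r_\alpha^\Omega$ (with respect to $\Omega$), with values in $[0,\infty]$, for $\bar a\in A^n,\bar b\in B^n$: $r_0(A\bar a,B\bar b)=\sup_\phi|\phi^A(\bar a)-\phi^B(\bar b)|$ over all basic formulas $\phi(x_0,\dots,x_{n-1})$ with $\Delta_\phi\le\Omega|_n$; $r_\alpha=\sup_{\beta<\alpha}r_\beta$ for $\alpha$ limit or $\alpha=\infty$ (greater than all ordinals); $r_{\alpha+1}(A\bar a,B\bar b)=\sup_{c\in A,d\in B}\inf_{c'\in A,d'\in B}\max\bigl(r_\alpha(A\bar ac,B\bar bd'),r_\alpha(A\bar ac',B\bar bd)\bigr)$. For $n=0$ write $r_\alpha(A,B)$. *)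

(* Defs.v *)
From HB Require Import structures.
From mathcomp Require Import all_boot all_order all_algebra.
From mathcomp Require Import all_classical all_reals all_analysis.
From mathcomp Require wochoice.

Set Implicit Arguments.
Unset Strict Implicit.
Unset Printing Implicit Defensive.

Import Order.TTheory GRing.Theory Num.Theory.
Import numFieldNormedType.Exports.

Local Open Scope classical_set_scope.
Local Open Scope ring_scope.

(* An n-tuple of elements of T is a function 'I_n -> T. *)

Section Tuples.
Variable T : Type.

Definition tnil (i : 'I_0) : T := match notF (ltn_ord i) with end.

Definition tsnoc n (a : 'I_n -> T) (c : T) : 'I_n.+1 -> T :=
  fun i => oapp a c (unlift ord_max i).

Definition tcat k n (a : 'I_k -> T) (b : 'I_n -> T) : 'I_(k + n) -> T :=
  fun i => match fintype.split i with inl j => a j | inr j => b j end.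

End Tuples.

Section Moduli.
Variable R : realType.

(* [0, oo)^I. A function on [0, oo)^I is represented by a function on R^I of
   which only the restriction to the orthant matters. *)
Definition orthant (I : Type) : set {ptws I -> R} :=
  [set delta | forall i, 0 <= delta i].
Arguments orthant : clear implicits.

Definition is_modulus (I : Type) (D : {ptws I -> R} -> R) : Prop :=
  [/\ {within orthant I, continuous D},
      D (fun=> 0) = 0,
      forall delta, orthant I delta -> 0 <= D delta &
      forall delta delta', orthant I delta -> orthant I delta' ->
        D delta <= D (fun i => delta i + delta' i) <= D delta + D delta'].

Definition is_weak_modulus (Om : {ptws nat -> R} -> \bar R) : Prop :=
  [/\ Om (fun=> 0) = 0%E,
      forall delta, orthant nat delta -> (0 <= Om delta)%E,
      forall delta delta', orthant nat delta -> orthant nat delta' ->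
        (Om delta <= Om (fun i => delta i + delta' i)%R)%E /\
        (Om (fun i => delta i + delta' i)%R <= Om delta + Om delta')%E,
      lower_semicontinuous (Om : subspace (orthant nat) -> \bar R) &
      forall (i : nat) delta, orthant nat delta ->
        {within [set t : R | 0 <= t],
          continuous (fun t : R => Om (dfwith delta i t))}].

Definition zero_extend n (delta : 'I_n -> R) : {ptws nat -> R} :=
  fun i => oapp delta 0 (insub i).

Definition trunc (Om : {ptws nat -> R} -> \bar R) n (delta : 'I_n -> R) :
  \bar R := Om (zero_extend delta).

Definition shift_increasing (Om : {ptws nat -> R} -> \bar R) : Prop :=
  forall (iota : nat -> nat) (delta delta' : {ptws nat -> R}),
    (forall p q, (p < q)%N -> (iota p < iota q)%N) ->
    orthant nat delta ->
    (forall p, delta' (iota p) = delta p) ->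
    (forall k, (forall p, iota p <> k) -> delta' k = 0) ->
    (Om delta <= Om delta')%E.

Definition tuple_dist (Om : {ptws nat -> R} -> \bar R) (X : metricType R) n
    (a b : 'I_n -> X) : \bar R :=
  trunc Om (fun i => mdist (a i) (b i)).

End Moduli.
Arguments orthant {R} I delta : rename.

(* The predicate symbols are [Dist], for the distance d, and [Pred P] for
   [P : psym]; the arity and the modulus of [Dist] are fixed below. *)
Record signature (R : realType) := Signature {
  fsym : Type;
  farity : fsym -> nat;
  fmod : forall F, ('I_(farity F) -> R) -> R;
  fmod_modulus : forall F, is_modulus (@fmod F);
  psym : Type;
  parity : psym -> nat;
  pmod : forall P, ('I_(parity P) -> R) -> R;
  pmod_modulus : forall P, is_modulus (@pmod P);
  pbound : psym -> R * R;
  pbound_le : forall P, (pbound P).1 <= (pbound P).2;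
  dbound : R * R;
  dbound_le : dbound.1 <= dbound.2 }.
Arguments fmod {R s} F.
Arguments pmod {R s} P.
Arguments pbound {R s} P.

Variant pred_symbol (R : realType) (L : signature R) :=
  | Dist
  | Pred of psym L.
Arguments Dist {R L}.

Section Language.
Variables (R : realType) (L : signature R).

Definition countable_signature : Prop :=
  countable [set: fsym L] /\ countable [set: pred_symbol L].

Definition pred_arity (P : pred_symbol L) : nat :=
  match P with Dist => 2 | Pred P => parity P end.

Definition pred_mod (P : pred_symbol L) : ('I_(pred_arity P) -> R) -> R :=
  match P with
  | Dist => fun delta => delta ord0 + delta ord_max
  | Pred P => pmod P
  end.

Definition pred_bound (P : pred_symbol L) : set R :=
  let I := match P with Dist => dbound L | Pred P => pbound P end in
  `[I.1, I.2].

(* Nonemptiness matters: the pair suprema in [bf_step] are vacuous as soon as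
   one of the two structures is empty. *)
Record structure := Structure {
  carrier :> metricType R;
  carrier_nonempty : [set: carrier] !=set0;
  carrier_complete : forall F : set_system carrier,
    ProperFilter F -> cauchy F -> exists x : carrier, F --> x;
  carrier_bound : forall x y : carrier, pred_bound Dist (mdist x y);
  fint : forall F : fsym L, ('I_(farity F) -> carrier) -> carrier;
  fint_respects : forall F (x y : 'I_(farity F) -> carrier),
    mdist (fint x) (fint y) <= fmod F (fun i => mdist (x i) (y i));
  pint : forall P : psym L, ('I_(parity P) -> carrier) -> R;
  pint_bound : forall P x, pred_bound (Pred P) (pint (P := P) x);
  pint_respects : forall P (x y : 'I_(parity P) -> carrier),
    `|pint x - pint y| <= pmod P (fun i => mdist (x i) (y i)) }.

Definition pred_int (A : structure) (P : pred_symbol L) :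
    ('I_(pred_arity P) -> A) -> R :=
  match P with
  | Dist => fun x => mdist (x ord0) (x ord_max)
  | Pred P => @pint A P
  end.

Definition separable (A : structure) : Prop :=
  exists2 D : set A, countable D & dense D.

Definition isomorphism (A B : structure) (f : A -> B) : Prop :=
  [/\ bijective f,
      forall (F : fsym L) (x : 'I_(farity F) -> A),
        f (fint x) = fint (f \o x) &
      forall (P : pred_symbol L) (x : 'I_(pred_arity P) -> A),
        pred_int (f \o x) = pred_int x].

Definition isomorphic (A B : structure) : Prop :=
  exists f : A -> B, isomorphism f.

(* Terms and formulas with variables among x_0, ..., x_(n-1). *)

Inductive term (n : nat) : Type :=
  | Var of 'I_n
  | App (F : fsym L) of ('I_(farity F) -> term n).

Fixpoint term_mod n (tau : term n) (delta : 'I_n -> R) : R :=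
  match tau with
  | Var i => delta i
  | App F args => fmod F (fun j => term_mod (args j) delta)
  end.

Fixpoint term_int (A : structure) n (tau : term n) (a : 'I_n -> A) : A :=
  match tau with
  | Var i => a i
  | App F args => fint (fun j => term_int (args j) a)
  end.

Record atomic (n : nat) : Type := Atomic {
  atom_pred : pred_symbol L;
  atom_args : 'I_(pred_arity atom_pred) -> term n }.

Definition atom_mod n (phi : atomic n) (delta : 'I_n -> R) : R :=
  pred_mod (fun j => term_mod (atom_args (a := phi) j) delta).

Definition atom_int (A : structure) n (phi : atomic n) (a : 'I_n -> A) : R :=
  pred_int (fun j => term_int (atom_args (a := phi) j) a).

Definition atoms_box n m (phi : 'I_m -> atomic n) : set {ptws 'I_m -> R} :=
  [set x | forall i, pred_bound (atom_pred (phi i)) (x i)].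

(* [basic_fun] matters only on the product of the bounds. *)
Record basic (n : nat) : Type := Basic {
  basic_size : nat;
  basic_atoms : 'I_basic_size -> atomic n;
  basic_fun : {ptws 'I_basic_size -> R} -> R;
  basic_cont : {within atoms_box basic_atoms, continuous basic_fun} }.

(* The supremum is real; taking it in \bar R needs no boundedness proof. *)
Definition basic_fun_mod n (phi : basic n)
    (delta : 'I_(basic_size phi) -> R) : \bar R :=
  ereal_sup [set e | exists x y : 'I_(basic_size phi) -> R,
    [/\ atoms_box (basic_atoms (b := phi)) x,
        atoms_box (basic_atoms (b := phi)) y,
        forall i, `|x i - y i| <= delta i &
        e = (`|basic_fun (b := phi) x - basic_fun (b := phi) y|)%:E]].

Definition basic_mod n (phi : basic n) (delta : 'I_n -> R) : \bar R :=
  basic_fun_mod (fun i => atom_mod (basic_atoms (b := phi) i) delta).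

Definition basic_int (A : structure) n (phi : basic n) (a : 'I_n -> A) : R :=
  basic_fun (b := phi) (fun i => atom_int (basic_atoms (b := phi) i) a).

(* In the first two clauses the n of Omega|_n is m + k, with m leading 0s. *)
Definition universal_weak_modulus (Om : {ptws nat -> R} -> \bar R) : Prop :=
  [/\ is_weak_modulus Om,
      forall k (phi : atomic k), exists m : nat,
        forall delta : 'I_k -> R, orthant 'I_k delta ->
          ((atom_mod phi delta)%:E <=
            trunc Om (tcat (fun _ : 'I_m => 0%R) delta))%E,
      forall k (M : R), 0 < M -> exists m : nat,
        forall delta : 'I_k -> R, orthant 'I_k delta ->
          (M%:E * trunc Om delta <=
            trunc Om (tcat (fun _ : 'I_m => 0%R) delta))%E,
      forall k n (delta : 'I_k -> R) (gamma : 'I_n -> R),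
        orthant 'I_k delta -> orthant 'I_n gamma ->
        (trunc Om delta + trunc Om gamma <= trunc Om (tcat delta gamma))%E &
      shift_increasing Om].

End Language.

(* An ordinal alpha is given by a well-order W and an element w of W, alpha
   being the order type of {v | v < w}. *)

Record wellOrder := WellOrder {
  wo_sort :> Type;
  wo_le : rel wo_sort;
  wo_leP : wochoice.well_order wo_le }.

Section WellOrders.
Variable W : wellOrder.

Definition wo_lt (v w : W) : Prop := wo_le v w /\ v <> w.

Lemma wo_lt_wf : well_founded wo_lt.
Proof.
move=> x; apply: contrapT => nAx.
pose P : {pred W} := fun y => `[< ~ Acc wo_lt y >].
have /(wo_leP (w := W))[z [[/asboolP nAz zmin] _]] : wochoice.nonempty P.
  by exists x; apply/asboolP.
apply: nAz; constructor=> y [yz neq_yz]; apply: contrapT => nAy.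
have zy : wo_le z y by apply: zmin; apply/asboolP.
pose Q : {pred W} := fun u => `[< u = y \/ u = z >].
have le_refl (u : W) : wo_le u u.
  have [] := @wo_leP W (fun v => `[< v = u >]); first by exists u; apply/asboolP.
  by move=> v [[/asboolP -> vmin] _]; apply: vmin; apply/asboolP.
have [] := @wo_leP W Q; first by exists y; apply/asboolP; left.
move=> u [_ uniq_u]; apply: neq_yz; transitivity u; last first.
- by apply: uniq_u; split; [apply/asboolP; right|move=> v /asboolP[->|->]].
- apply/esym/uniq_u; split; first by apply/asboolP; left.
  by move=> v /asboolP[->|->].
Qed.

(* w is the successor of v *)
Definition wo_succ (v w : W) : Prop :=
  wo_lt v w /\ forall u, wo_lt u w -> wo_lt u v \/ u = v.

Lemma wo_succ_inj (u v w : W) : wo_succ u w -> wo_succ v w -> u = v.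
Proof.
move=> [uw umax] [vw vmax].
case: (umax v vw) => [vu|//]; case: (vmax u uw) => [uv|//].
have : ~ Acc wo_lt u; last by case; apply: wo_lt_wf.
move=> Au; elim: Au v vu uv {vw vmax umax uw} => x _ IH y yx xy.
exact: (IH y yx x xy yx).
Qed.

End WellOrders.

Section BackAndForth.
Variables (R : realType) (L : signature R).
Variables (Om : {ptws nat -> R} -> \bar R) (A B : structure L).
Local Open Scope ereal_scope.

Definition tuple_pseudodist :=
  forall n, ('I_n -> A) -> ('I_n -> B) -> \bar R.

Definition bf_zero : tuple_pseudodist := fun n a b =>
  ereal_sup [set (`|basic_int phi a - basic_int phi b|)%:E | phi in
    [set phi : basic L n | forall delta : 'I_n -> R, orthant 'I_n delta ->
                             basic_mod phi delta <= trunc Om delta]].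

Definition bf_step (r : tuple_pseudodist) : tuple_pseudodist := fun n a b =>
  ereal_sup [set
    ereal_inf [set
      maxe (r n.+1 (tsnoc a cd.1) (tsnoc b cd'.2))
           (r n.+1 (tsnoc a cd'.1) (tsnoc b cd.2))
      | cd' in [set: A * B]]
    | cd in [set: A * B]].

Definition bf_rec (W : wellOrder) (w : W)
    (rec : forall v, wo_lt v w -> tuple_pseudodist) : tuple_pseudodist :=
  match pselect (exists v, wo_succ v w) with
  | left ex => let: exist v vw := cid ex in bf_step (rec v vw.1)
  | right _ =>
    match pselect (exists v, wo_lt v w) with
    | left _ => fun n a b =>
        ereal_sup [set rec (sval v) (svalP v) n a b | v in
                     [set: {v | wo_lt v w}]]
    | right _ => bf_zero
    end
  end.

Definition bf_rank (W : wellOrder) : W -> tuple_pseudodist :=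
  Fix (wo_lt_wf (W := W)) (fun=> tuple_pseudodist) (bf_rec (W := W)).

Lemma bf_rankE (W : wellOrder) (w : W) :
  bf_rank w = bf_rec (fun v (_ : wo_lt v w) => bf_rank v).
Proof.
rewrite /bf_rank Fix_eq // => u f g fg; congr bf_rec.
by apply: functional_extensionality_dep => v; apply/funext => vw; apply: fg.
Qed.

Lemma bf_rank0 (W : wellOrder) (w : W) :
  (forall v, ~ wo_lt v w) -> bf_rank w = bf_zero.
Proof.
move=> w0; rewrite bf_rankE /bf_rec.
case: pselect => [ex|_]; first by have [v [/w0]] := ex.
by case: pselect => [[v vw]|//]; case: (w0 v).
Qed.

Lemma bf_rankS (W : wellOrder) (v w : W) :
  wo_succ v w -> bf_rank w = bf_step (bf_rank v).
Proof.
move=> vw; rewrite bf_rankE /bf_rec; case: pselect => [ex|[]]; last by exists v.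
by case: cid => u uw; rewrite (wo_succ_inj uw vw).
Qed.

Lemma bf_rank_limit (W : wellOrder) (w : W) :
  (exists v, wo_lt v w) -> (forall v, ~ wo_succ v w) ->
  forall n (a : 'I_n -> A) (b : 'I_n -> B),
  bf_rank w a b = ereal_sup [set bf_rank v a b | v in [set v | wo_lt v w]].
Proof.
move=> w0 wl n a b; rewrite bf_rankE /bf_rec.
case: pselect => [ex|_]; first by have [v /wl] := ex.
case: pselect => [ex|//].
congr ereal_sup; apply/seteqP; split=> x [].
- by move=> [v vw] _ <-; exists v.
- by move=> v vw <-; exists (exist _ v vw).
Qed.

Definition bf_infty : tuple_pseudodist := fun n a b =>
  ereal_sup [set e | exists (W : wellOrder) (w : W), e = bf_rank w a b].

End BackAndForth.

(* Main.v *)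
Require Import Defs.
From mathcomp Require Import all_boot all_order all_algebra.
From mathcomp Require Import all_classical all_reals all_analysis.
From mathcomp Require Import lra zify.
From mathcomp Require wochoice.

Set Implicit Arguments.
Unset Strict Implicit.
Unset Printing Implicit Defensive.

Import Order.TTheory GRing.Theory Num.Theory.
Import numFieldNormedType.Exports.

Local Open Scope classical_set_scope.
Local Open Scope ring_scope.

(** The ranks r_alpha are nondecreasing, so they stall on a well-order too long
    to inject into the set of pseudo-distances. Hence r_oo is a fixed point of
    the back-and-forth step, and the least one above r_0.

    Upper bound: for an isomorphism f, d^Om(f a, b) dominates r_0 and is
    preserved by the step, answering c with f c and d with f^-1 d.

    Lower bound: if r_oo (v, w) < s, the fixed point property extends v and w to
    sequences (a_n), (b_n), each coming infinitely often close to every point,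
    with r_0 <= s on all initial segments. By the scaling conditions on Om,
    atomic formulas take asymptotically the same values along both sequences,
    so the cluster points of (a_n, b_n) in A x B form the graph of an
    isomorphism f. Finally d^Om(f v, w) <= s is read off the formulas
    Om(d(x_i, x_(j_i)))_i with a_(j_i) close to v_i and b_(j_i) close to
    f v_i; superadditivity of Om bounds their moduli. *)

(** * Tuples, increasing index tuples and extension by zero *)

Section TupleSnoc.
Variables (T : Type) (n : nat).

Lemma tsnoc_lift (a : 'I_n -> T) c i : tsnoc a c (lift ord_max i) = a i.
Proof. by rewrite /tsnoc liftK. Qed.

Lemma tsnoc_max (a : 'I_n -> T) c : tsnoc a c ord_max = c.
Proof. by rewrite /tsnoc unlift_none. Qed.

Lemma tsnocP (a : 'I_n -> T) c (b : 'I_n.+1 -> T) :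
  (forall i, b (lift ord_max i) = a i) -> b ord_max = c -> b = tsnoc a c.
Proof.
move=> ba bc; apply/funext => i; case: (unliftP ord_max i) => [j ->|->].
  by rewrite tsnoc_lift.
by rewrite tsnoc_max.
Qed.

End TupleSnoc.

Lemma comp_tsnoc T U (f : T -> U) n (a : 'I_n -> T) c :
  f \o tsnoc a c = tsnoc (f \o a) (f c).
Proof. by apply: tsnocP => [i|] /=; rewrite ?tsnoc_lift ?tsnoc_max. Qed.

Definition increasing_tuple m (sigma : 'I_m -> nat) :=
  forall i j : 'I_m, (i < j)%N -> (sigma i < sigma j)%N.

Lemma comp_tcat T U (h : T -> U) k n (a : 'I_k -> T) (b : 'I_n -> T) :
  h \o tcat a b = tcat (h \o a) (h \o b).
Proof. by apply/funext => i; rewrite /= /tcat; case: fintype.split. Qed.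

Lemma tcat_increasing k n (sigma : 'I_k -> nat) (tau : 'I_n -> nat) :
  increasing_tuple sigma -> increasing_tuple tau ->
  (forall i j, (sigma i < tau j)%N) -> increasing_tuple (tcat sigma tau).
Proof.
move=> sigma_inc tau_inc sigma_tau i j; rewrite /tcat.
case: (fintype.splitP i) => i' ->; case: (fintype.splitP j) => j' -> //.
- exact: sigma_inc.
- by rewrite ltnNge (leq_trans (ltnW (ltn_ord j')))// leq_addr.
- by rewrite ltn_add2l; exact: tau_inc.
Qed.

(** Greedy choice: each index is sought beyond the previous one. A shift-increasing [Om] compares
    increasing index tuples, so approximations must be found at such indices. *)
Lemma increasing_choice m (P : 'I_m -> nat -> Prop) :
  (forall i N, exists2 n, (N <= n)%N & P i n) ->
  forall N, exists j, [/\ increasing_tuple j, forall i, (N <= j i)%N &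
                        forall i, P i (j i)].
Proof.
move=> P_inf N.
have /choice[g gP] : forall iN : 'I_m * nat,
    exists n, (iN.2 <= n)%N /\ P iN.1 n.
  by move=> [i M]; have [n] := P_inf i M; exists n.
(* Past [m], [g'] returns its lower bound, so that [h] is strictly increasing on all of [nat]. *)
pose g' t M := if insub t is Some i then g (i, M) else M.
have g'_ge t M : (M <= g' t M)%N.
  by rewrite /g'; case: insub => // i; have [] := gP (i, M).
pose h := fix h t := g' t (if t is t'.+1 then (h t').+1 else N).
have h_lt : {homo h : s t / (s < t)%N}.
  by apply: homo_ltn => [? ? ?|t]; [exact: ltn_trans|exact: g'_ge].
have hE (i : 'I_m) : exists M, h i = g (i, M).
  by case: i => -[|t] lt_tm; eexists; rewrite /= /g' insubT.
exists (fun i => h i); split=> [i j|i|i]; first exact: h_lt.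
- apply: (@leq_trans (h 0%N)); first exact: g'_ge.
  by case: (nat_of_ord i) => // t; exact/ltnW/h_lt.
- by have [M ->] := hE i; have [] := gP (i, M).
Qed.

Section ZeroExtend.
Variable R : realType.

Lemma zero_extend_lt n (delta : 'I_n -> R) (i : 'I_n) :
  zero_extend delta i = delta i.
Proof. by rewrite /zero_extend valK. Qed.

Lemma zero_extend_ge n (delta : 'I_n -> R) i :
  (n <= i)%N -> zero_extend delta i = 0.
Proof. by move=> le_ni; rewrite /zero_extend insubF// ltnNge le_ni. Qed.

Lemma zero_extend_ge0 n (delta : 'I_n -> R) :
  orthant 'I_n delta -> orthant nat (zero_extend delta).
Proof. by move=> d0 i; rewrite /zero_extend; case: insubP => [j _ _|_] /=. Qed.

Lemma zero_extendD n (delta delta' : 'I_n -> R) :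
  zero_extend (fun i => delta i + delta' i) =
  (fun i => zero_extend delta i + zero_extend delta' i).
Proof.
apply/funext => i; rewrite /zero_extend.
by case: insub => [j|]//=; rewrite addr0.
Qed.

Lemma zero_extend_snoc0 n (delta : 'I_n -> R) :
  zero_extend (tsnoc delta 0) = zero_extend delta.
Proof.
apply/funext => i; have [lt_in|] := ltnP i n.
  rewrite (zero_extend_lt _ (Ordinal lt_in)).
  by rewrite -(tsnoc_lift delta 0) -zero_extend_lt lift_max.
rewrite leq_eqVlt => /predU1P[<-|lt_ni]; last by rewrite !zero_extend_ge// ltnW.
rewrite [RHS]zero_extend_ge//.
by rewrite (zero_extend_lt _ (ord_max : 'I_n.+1)) tsnoc_max.
Qed.

Lemma zero_extend_tcat k n (a : 'I_k -> R) (b : 'I_n -> R) i :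
  zero_extend (tcat a b) i =
  if (i < k)%N then zero_extend a i else zero_extend b (i - k)%N.
Proof.
case: (ltnP i (k + n)) => [lt_ikn|le_kni]; last first.
  rewrite zero_extend_ge// ltnNge (leq_trans (leq_addr n k) le_kni)/=.
  by rewrite zero_extend_ge// leq_subRL// (leq_trans (leq_addr n k)).
rewrite (zero_extend_lt _ (Ordinal lt_ikn)) /tcat.
case: fintype.splitP => j /= ->; first by rewrite ltn_ord zero_extend_lt.
by rewrite ltnNge leq_addr/= addKn zero_extend_lt.
Qed.

End ZeroExtend.

(** * Weak moduli *)

Lemma modulus_mono (R : realType) I (D : {ptws I -> R} -> R) delta delta' :
  is_modulus D -> orthant I delta -> (forall i, delta i <= delta' i) ->
  D delta <= D delta'.
Proof.
move=> [_ _ _ D_mono] delta_ge0 le_dd'.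
have sub_ge0 : orthant I (fun i => delta' i - delta i).
  by move=> i; rewrite subr_ge0.
have /andP[+ _] := D_mono _ _ delta_ge0 sub_ge0.
rewrite (_ : (fun i => delta i + (delta' i - delta i))%R = delta') //.
by apply/funext => i; rewrite subrKC.
Qed.

Section WeakModulus.
Variables (R : realType) (Om : {ptws nat -> R} -> \bar R).
Hypothesis Om_modulus : is_weak_modulus Om.
Local Open Scope ereal_scope.

Lemma weak_modulus_mono (delta delta' : nat -> R) :
  orthant nat delta -> (forall i, delta i <= delta' i)%R ->
  Om delta <= Om delta'.
Proof.
have [_ _ Om_sub _ _] := Om_modulus; move=> delta_ge0 le_dd'.
have sub_ge0 : orthant nat (fun i => delta' i - delta i)%R.
  by move=> i; rewrite subr_ge0.
have [+ _] := Om_sub _ _ delta_ge0 sub_ge0.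
rewrite (_ : (fun i => delta i + (delta' i - delta i))%R = delta') //.
by apply/funext => i; rewrite subrKC.
Qed.

Lemma trunc_ge0 n (delta : 'I_n -> R) :
  orthant 'I_n delta -> 0 <= trunc Om delta.
Proof. by case: Om_modulus => _ + _ _ _ d0; apply; apply: zero_extend_ge0. Qed.

Lemma trunc_mono n (delta delta' : 'I_n -> R) :
  orthant 'I_n delta -> (forall i, delta i <= delta' i)%R ->
  trunc Om delta <= trunc Om delta'.
Proof.
move=> d0 le_dd'; apply: weak_modulus_mono; first exact: zero_extend_ge0.
by move=> i; rewrite /zero_extend; case: insub => [j|] /=.
Qed.

Lemma trunc_leD n (delta delta' : 'I_n -> R) :
  orthant 'I_n delta -> orthant 'I_n delta' ->
  trunc Om (fun i => delta i + delta' i)%R <= trunc Om delta + trunc Om delta'.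
Proof.
have [_ _ Om_sub _ _] := Om_modulus; move=> d0 d'0; rewrite /trunc zero_extendD.
by have [] := Om_sub _ _ (zero_extend_ge0 d0) (zero_extend_ge0 d'0).
Qed.

(** Separate continuity becomes joint continuity at 0 on finitely many coordinates: by induction,
    the last coordinate is split off by subadditivity and each part costs at most [e / 2]. *)
Lemma weak_modulus_small n (e : R) : (0 < e)%R ->
  exists2 eta : R, (0 < eta)%R & forall delta : nat -> R, orthant nat delta ->
    (forall i, delta i <= eta)%R -> (forall i, (n <= i)%N -> delta i = 0%R) ->
    Om delta <= e%:E.
Proof.
have [Om0 _ Om_sub _ Om_cont] := Om_modulus.
elim: n e => [|n IHn] e e0.
  exists 1%R => // delta _ _ d0; rewrite (_ : delta = fun=> 0%R).
    by rewrite Om0 lee_fin ltW.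
  by apply/funext => i; apply: d0.
have e20 : (0 < e / 2)%R by rewrite divr_gt0.
have [eta eta0 eta_small] := IHn _ e20.
have orth0 : orthant nat (fun=> 0%R : R) by move=> i.
have := Om_cont n (fun=> 0%R) orth0.
have dfwith0 : @dfwith nat (fun=> R) (fun=> 0%R) n 0%R = fun=> 0%R.
  by apply/funext => i; case: dfwithP.
move=> /subspace_continuousP/(_ 0%R)/=; rewrite lexx => /(_ isT).
rewrite /from_subspace dfwith0 Om0.
have nbh : nbhs (0 : \bar R) [set x | x < (e / 2)%:E].
  have := @open_nbhs_nbhs _ (0 : \bar R) [set x | x < (e / 2)%:E]; apply.
  by split; [exact: open_ereal_lt_ereal|rewrite /= lte_fin].
move=> /(_ _ nbh); rewrite /nbhs/= /within/= => /nbhs_ballP[t /= t0 t_small].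
(* [t] is halved because the ball around 0 is open, while [delta n <= u] is not strict. *)
pose u := Num.min eta (t / 2)%R.
have u0 : (0 < u)%R by rewrite lt_min eta0 divr_gt0.
exists u => // delta delta_ge0 delta_le delta_n.
pose d1 : nat -> R := fun i => if i == n then 0%R else delta i.
pose d2 : nat -> R := dfwith (fun=> 0%R) n (delta n).
have d1_ge0 : orthant nat d1 by move=> i; rewrite /d1; case: ifP.
have d2_ge0 : orthant nat d2 by move=> i; rewrite /d2; case: dfwithP.
rewrite (_ : delta = fun i => d1 i + d2 i)%R; last first.
  apply/funext => i; rewrite /d1 /d2; case: dfwithP => [|j nj].
    by rewrite eqxx add0r.
  by rewrite eq_sym (negbTE nj) addr0.
apply: le_trans (Om_sub _ _ d1_ge0 d2_ge0).2 _.
rewrite [e]splitr EFinD leeD//.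
  apply: eta_small => // i.
    rewrite /d1; case: ifP => _; first exact: ltW.
    by rewrite (le_trans (delta_le i))// ge_min lexx.
  by rewrite leq_eqVlt /d1 eq_sym; case: eqP => //= _; apply: delta_n.
apply/ltW/t_small => /=; last exact: (delta_ge0 n).
rewrite /ball/= sub0r normrN ger0_norm; last exact: delta_ge0.
rewrite (le_lt_trans (delta_le n))//.
by rewrite gt_min ltr_pdivrMr// ltr_pMr// ltr1n orbT.
Qed.

Lemma trunc_small n (e : R) : (0 < e)%R ->
  exists2 eta : R, (0 < eta)%R & forall delta : 'I_n -> R, orthant 'I_n delta ->
    (forall i, delta i <= eta)%R -> trunc Om delta <= e%:E.
Proof.
move=> /(weak_modulus_small n)[eta eta0 eta_small].
exists eta => // delta d0 le_d.
apply: eta_small; first exact: zero_extend_ge0.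
  by move=> i; rewrite /zero_extend; case: insub => [j|] //=; exact: ltW.
by move=> i; exact: zero_extend_ge.
Qed.

Lemma trunc_muln n (delta : 'I_n -> R) m : orthant 'I_n delta ->
  trunc Om (fun i => delta i *+ m)%R <= trunc Om delta *+ m.
Proof.
move=> d0; elim: m => [|m IHm].
  have [Om0 _ _ _ _] := Om_modulus; rewrite mule0n -[X in _ <= X]Om0.
  apply: weak_modulus_mono.
    by apply: zero_extend_ge0 => i; rewrite mulr0n.
  by move=> i; rewrite /zero_extend; case: insub => [j|] //=; rewrite mulr0n.
rewrite (_ : (fun i => _) = (fun i => delta i + delta i *+ m)%R); last first.
  by apply/funext => i; rewrite mulrS.
apply: le_trans (trunc_leD _ _) _ => //; first by move=> i; rewrite mulrn_wge0.
by rewrite muleS leeD.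
Qed.

(** [Om] may take the value [+oo], but not at a finite tuple: for large [m] the value at [delta / m]
    is at most 1, and subadditivity adds up [m] copies. *)
Lemma trunc_fin_num n (delta : 'I_n -> R) :
  orthant 'I_n delta -> trunc Om delta \is a fin_num.
Proof.
move=> d0; have [eta eta0 eta_small] := @trunc_small n 1%R ltr01.
rewrite ge0_fin_numE ?trunc_ge0//.
pose m := (Num.bound ((\sum_i delta i) / eta)).+1.
have -> : delta = (fun i => (delta i / m%:R) *+ m)%R.
  by apply/funext => i; rewrite -mulr_natr divfK// pnatr_eq0.
have dm0 : orthant 'I_n (fun i => delta i / m%:R)%R.
  by move=> i; rewrite divr_ge0 ?d0.
apply: le_lt_trans (trunc_muln m dm0) _.
have le1 : trunc Om (fun i => delta i / m%:R)%R <= 1%:E.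
  apply: eta_small => // i; rewrite ler_pdivrMr// mulrC -ler_pdivrMr//.
  rewrite (@le_trans _ _ ((\sum_i delta i) / eta)%R)//.
    by rewrite ler_pM2r ?invr_gt0// (bigD1 i)//= lerDl sumr_ge0.
  rewrite ltW// (lt_le_trans (archi_boundP _))//.
    by rewrite divr_ge0 ?sumr_ge0 ?ltW// => j _; exact: (d0 j).
  by rewrite ler_nat.
have fin_dm : trunc Om (fun i => delta i / m%:R)%R \is a fin_num.
  by rewrite ge0_fin_numE ?trunc_ge0// (le_lt_trans le1) ?ltry.
by rewrite -(fineK fin_dm) -EFin_natmul ltry.
Qed.

(** Shift-increase needs an infinite index sequence, so [sigma] is continued past its maximum, where
    the zero extension of [delta \o sigma] vanishes. The comparison passes through [delta'], which
    is [delta] cut down to the range of [sigma]. *)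
Lemma trunc_subtuple m (sigma : 'I_m -> nat) (delta : nat -> R) :
  shift_increasing Om -> increasing_tuple sigma -> orthant nat delta ->
  trunc Om (delta \o sigma) <= Om delta.
Proof.
move=> Om_shift sigma_inc d0.
pose M := (\max_i sigma i).+1.
pose iota p := if insub p is Some i then sigma i else (M + p)%N.
have iota_lt (i : 'I_m) : iota i = sigma i by rewrite /iota valK.
have iota_ge p : (m <= p)%N -> iota p = (M + p)%N.
  by move=> le_mp; rewrite /iota insubF// ltnNge le_mp.
have sigma_lt i : (sigma i < M)%N by rewrite ltnS leq_bigmax.
have iota_inc p q : (p < q)%N -> (iota p < iota q)%N.
  move=> lt_pq; have [lt_qm|le_mq] := ltnP q m.
    have lt_pm := ltn_trans lt_pq lt_qm.
    by rewrite (iota_lt (Ordinal lt_pm)) (iota_lt (Ordinal lt_qm)) sigma_inc.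
  rewrite (iota_ge q)//; have [lt_pm|le_mp] := ltnP p m.
    rewrite (iota_lt (Ordinal lt_pm)) (leq_trans (sigma_lt _))//.
    exact: leq_addr.
  by rewrite iota_ge// ltn_add2l.
pose delta' k := if `[< exists i, sigma i = k >] then delta k else 0%R.
apply: (@le_trans _ _ (Om delta')).
  apply: (Om_shift iota) => //; first by apply: zero_extend_ge0 => i; exact: d0.
    move=> p; have [lt_pm|le_mp] := ltnP p m.
      rewrite (zero_extend_lt _ (Ordinal lt_pm)) (iota_lt (Ordinal lt_pm)).
      by rewrite /delta' asboolT//; exists (Ordinal lt_pm).
    rewrite zero_extend_ge// /delta' asboolF// iota_ge// => -[i] si.
    by have := sigma_lt i; rewrite si ltnNge leq_addr.
  move=> k nk; rewrite /delta' asboolF// => -[i si]; apply: (nk i).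
  by rewrite iota_lt.
have d'0 : orthant nat delta' by move=> k; rewrite /delta'; case: ifP.
by apply: weak_modulus_mono => // k; rewrite /delta'; case: ifP.
Qed.

End WeakModulus.

(** * Continuity of truncated weak moduli on finite powers *)

Section FinitePointwise.
Variables (R : realType) (n : nat).

Lemma continuous_fin_ptws (f : {ptws 'I_n -> R} -> R) :
  (forall x e, 0 < e -> exists2 eta, 0 < eta &
    forall y, (forall i, `|x i - y i| <= eta) -> `|f x - f y| <= e) ->
  continuous f.
Proof.
move=> f_unif x; have nx := nbhs_filter x.
have dist_le := @cvgrPdist_le R R {ptws 'I_n -> R} (nbhs x) nx.
apply: (iffRL (dist_le f (f x))) => e /(f_unif x)[eta eta0 f_eta].
apply: (@filterS _ _ nx _ _ f_eta).
apply: (@filter_forall _ _ (fun i => [set y | `|x i - y i| <= eta]) _ nx) => i.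
have := iffLR (dist_le (fun y => y i) (x i)) (@proj_continuous _ (fun=> R) i x).
by move=> /(_ eta eta0).
Qed.

Lemma scale_coord_continuous (M : R) (i : 'I_n) :
  continuous (fun x : {ptws 'I_n -> R} => M * x i : R).
Proof.
move=> x; apply: (@continuous_comp _ R R (fun x : {ptws 'I_n -> R} => x i : R)).
  exact: (@proj_continuous _ (fun=> R) i x).
exact: mulrl_continuous.
Qed.

Variable Om : {ptws nat -> R} -> \bar R.
Hypothesis Om_modulus : is_weak_modulus Om.

(** Subadditivity and monotonicity applied to [max(x, 0) <= max(y, 0) + |x - y|], and symmetrically.
    This yields both the continuity and the modulus of [dist_formula]. *)
Lemma trunc_pos_part_dist (x y : 'I_n -> R) :
  (`|fine (trunc Om (fun i => Num.max (x i) 0%R)) -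
     fine (trunc Om (fun i => Num.max (y i) 0%R))|%R%:E <=
   trunc Om (fun i => `|x i - y i|%R))%E.
Proof.
have pos_part (u : 'I_n -> R) : orthant 'I_n (fun i => Num.max (u i) 0).
  by move=> i; rewrite le_max lexx orbT.
have norm0 (u : 'I_n -> R) : orthant 'I_n (fun i => `|u i|).
  by move=> i; exact: normr_ge0.
have half (u t : 'I_n -> R) : (trunc Om (fun i => Num.max (u i) 0%R) <=
    trunc Om (fun i => Num.max (t i) 0%R) +
    trunc Om (fun i => `|u i - t i|%R))%E.
  apply: le_trans _ (trunc_leD Om_modulus (pos_part t) (norm0 _)).
  apply: trunc_mono => // i; rewrite ge_max; apply/andP; split.
    rewrite -lerBlDl; apply: le_trans _ (ler_norm _).
    by rewrite lerB// le_max lexx.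
  by rewrite addr_ge0// le_max lexx orbT.
have norm_fin := trunc_fin_num Om_modulus (norm0 (fun i => x i - y i)).
rewrite -(fineK norm_fin) lee_fin.
rewrite ler_distl; apply/andP; split.
  have := half y x.
  under [X in (_ <= _ + trunc Om X)%E]funext do rewrite distrC.
  rewrite -[X in (X <= _)%E]fineK ?trunc_fin_num//.
  rewrite -[X in (_ <= X + _)%E]fineK ?trunc_fin_num//.
  rewrite -[X in (_ <= _ + X)%E]fineK ?norm_fin//.
  by rewrite -EFinD lee_fin lerBlDr.
have := half x y.
rewrite -[X in (X <= _)%E]fineK ?trunc_fin_num//.
rewrite -[X in (_ <= X + _)%E]fineK ?trunc_fin_num//.
rewrite -[X in (_ <= _ + X)%E]fineK ?norm_fin//.
Qed.

Lemma trunc_pos_part_continuous :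
  continuous (fun x : {ptws 'I_n -> R} =>
    fine (trunc Om (fun i => Num.max (x i) 0)) : R).
Proof.
apply: continuous_fin_ptws => x e e0.
have [eta eta0 eta_small] := trunc_small Om_modulus n e0.
exists eta => // y le_xy; rewrite -lee_fin.
apply: le_trans (trunc_pos_part_dist _ _) (eta_small _ _ _) => //.
Qed.

End FinitePointwise.

(** * Terms and formulas *)

Section Syntax.
Variables (R : realType) (L : signature R).

Fixpoint term_rename m n (sigma : 'I_m -> 'I_n) (tau : term L m) : term L n :=
  match tau with
  | Var i => Var L (sigma i)
  | App F args => App (fun j => term_rename sigma (args j))
  end.

Definition atom_rename m n (sigma : 'I_m -> 'I_n) (phi : atomic L m) :
    atomic L n :=
  Atomic (fun j => term_rename sigma (atom_args (a := phi) j)).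

Definition basic_rename m n (sigma : 'I_m -> 'I_n) (phi : basic L m) :
    basic L n :=
  @Basic R L n (basic_size phi)
    (fun i => atom_rename sigma (basic_atoms (b := phi) i))
    (basic_fun (b := phi)) (basic_cont (b := phi)).

Section Rename.
Variables (m n : nat) (sigma : 'I_m -> 'I_n).

Lemma term_mod_rename tau delta :
  term_mod (term_rename sigma tau) delta = term_mod tau (delta \o sigma).
Proof.
by elim: tau => [i|F args IH] //=; congr fmod; apply/funext => j; apply: IH.
Qed.

Lemma atom_mod_rename phi delta :
  atom_mod (atom_rename sigma phi) delta = atom_mod phi (delta \o sigma).
Proof.
by congr pred_mod; apply/funext => j; exact: term_mod_rename.
Qed.

Lemma basic_mod_rename phi delta :
  basic_mod (basic_rename sigma phi) delta = basic_mod phi (delta \o sigma).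
Proof.
rewrite /basic_mod.
have -> : (fun i => atom_mod (basic_atoms (b := phi) i) (delta \o sigma)) =
  (fun i => atom_mod (basic_atoms (b := basic_rename sigma phi) i) delta).
  by apply/funext => i; rewrite atom_mod_rename.
by [].
Qed.

Variable A : structure L.

Lemma term_int_rename tau (a : 'I_n -> A) :
  term_int (term_rename sigma tau) a = term_int tau (a \o sigma).
Proof.
by elim: tau => [i|F args IH] //=; congr fint; apply/funext => j; apply: IH.
Qed.

Lemma atom_int_rename phi (a : 'I_n -> A) :
  atom_int (atom_rename sigma phi) a = atom_int phi (a \o sigma).
Proof. by congr pred_int; apply/funext => j; exact: term_int_rename. Qed.

Lemma basic_int_rename phi (a : 'I_n -> A) :
  basic_int (basic_rename sigma phi) a = basic_int phi (a \o sigma).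
Proof. by congr basic_fun; apply/funext => j; exact: atom_int_rename. Qed.

End Rename.

Lemma pred_mod_mono (P : pred_symbol L)
    (delta delta' : 'I_(pred_arity P) -> R) :
  orthant _ delta -> (forall i, delta i <= delta' i) ->
  pred_mod delta <= pred_mod delta'.
Proof.
case: P delta delta' => [|P] delta delta' d0 le_dd' /=; first by rewrite lerD.
exact: modulus_mono (pmod_modulus _) _ _.
Qed.

Lemma pred_int_dist (A : structure L) (P : pred_symbol L)
    (x y : 'I_(pred_arity P) -> A) :
  `|pred_int x - pred_int y| <= pred_mod (fun i => mdist (x i) (y i)).
Proof.
case: P x y => [|P] x y /=; last exact: pint_respects.
have := metric_triangle (x ord0) (y ord0) (x ord_max).
have := metric_triangle (y ord0) (y ord_max) (x ord_max).
have := metric_triangle (y ord0) (x ord0) (y ord_max).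
have := metric_triangle (x ord0) (x ord_max) (y ord_max).
rewrite (metric_sym (y ord0) (x ord0)) (metric_sym (y ord_max) (x ord_max)).
by rewrite ler_norml; lra.
Qed.

Lemma pred_int_bound (A : structure L) (P : pred_symbol L)
    (x : 'I_(pred_arity P) -> A) :
  pred_bound P (pred_int x).
Proof. by case: P x => [|P] x; [exact: carrier_bound|exact: pint_bound]. Qed.

Lemma term_int_dist (A : structure L) n (tau : term L n) (a b : 'I_n -> A) :
  mdist (term_int tau a) (term_int tau b) <=
  term_mod tau (fun i => mdist (a i) (b i)).
Proof.
elim: tau => [i|F args IH] //=; apply: le_trans (fint_respects _ _) _.
by apply: modulus_mono (@fmod_modulus _ _ F) _ IH => i; exact: mdist_ge0.
Qed.

Lemma atom_int_dist (A : structure L) n (phi : atomic L n) (a b : 'I_n -> A) :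
  `|atom_int phi a - atom_int phi b| <=
  atom_mod phi (fun i => mdist (a i) (b i)).
Proof.
apply: le_trans (pred_int_dist _ _) _; apply: pred_mod_mono => i.
  exact: mdist_ge0.
exact: term_int_dist.
Qed.

(** The atom values at [a] and at [b] form one of the pairs in the supremum defining [basic_mod]. *)
Lemma basic_int_dist (A : structure L) n (phi : basic L n) (a b : 'I_n -> A) :
  (`|basic_int phi a - basic_int phi b|%:E <=
   basic_mod phi (fun i => mdist (a i) (b i)))%E.
Proof.
apply: ereal_sup_ubound => /=.
exists (fun i => atom_int (basic_atoms (b := phi) i) a).
exists (fun i => atom_int (basic_atoms (b := phi) i) b).
by split=> // i; [exact: pred_int_bound..|exact: atom_int_dist].
Qed.

Section Isomorphism.
Variables (A B : structure L) (f : A -> B).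
Hypothesis f_iso : isomorphism f.

Lemma term_int_iso n (tau : term L n) (a : 'I_n -> A) :
  term_int tau (f \o a) = f (term_int tau a).
Proof.
have [_ f_fun _] := f_iso.
elim: tau => [i|F args IH] //=; rewrite f_fun; congr fint.
by apply/funext => j; rewrite IH.
Qed.

Lemma atom_int_iso n (phi : atomic L n) (a : 'I_n -> A) :
  atom_int phi (f \o a) = atom_int phi a.
Proof.
have [_ _ f_pred] := f_iso; rewrite /atom_int -f_pred; congr pred_int.
by apply/funext => j; exact: term_int_iso.
Qed.

Lemma basic_int_iso n (phi : basic L n) (a : 'I_n -> A) :
  basic_int phi (f \o a) = basic_int phi a.
Proof. by congr basic_fun; apply/funext => j; exact: atom_int_iso. Qed.

End Isomorphism.

End Syntax.

(** * Back-and-forth ranks *)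

Section WellOrders.
Variable W : wellOrder.

(** A well-order is given by unique least elements of nonempty subsets. Totality comes from the
    least element of a pair, and asymmetry below from its uniqueness. *)
Lemma wo_le_total (v w : W) : wo_le v w || wo_le w v.
Proof.
have := @wo_leP W [pred u | `[< u = v \/ u = w >]].
case=> [|u [[/asboolP uvw umin] _]]; first by exists v; apply/asboolP; left.
have uv : wo_le u v by apply: umin; apply/asboolP; left.
have uw : wo_le u w by apply: umin; apply/asboolP; right.
by case: uvw uv uw => <- uv uw; rewrite ?uv ?uw ?orbT.
Qed.

Lemma wo_lt_asym (v w : W) : wo_lt v w -> ~ wo_lt w v.
Proof.
move=> [vw neq_vw] [wv _]; apply: neq_vw.
have refl (u : W) : wo_le u u by have := wo_le_total u u; rewrite orbb.
have := @wo_leP W [pred u | `[< u = v \/ u = w >]].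
case=> [|u [_ uniq_u]]; first by exists v; apply/asboolP; left.
transitivity u; [apply/esym|]; apply: uniq_u; split.
- by apply/asboolP; left.
- by move=> x /asboolP[->|->].
- by apply/asboolP; right.
- by move=> x /asboolP[->|->].
Qed.

Lemma wo_lt_total (v w : W) : v <> w -> wo_lt v w \/ wo_lt w v.
Proof.
move=> vw; have /orP[vw'|wv] := wo_le_total v w; first by left.
by right; split=> // /esym.
Qed.

(** The successor is the least element above [v]; [w] shows that there is one. *)
Lemma wo_succ_exists (v w : W) : wo_lt v w ->
  exists2 u, wo_succ v u & u = w \/ wo_lt u w.
Proof.
move=> vw; have := @wo_leP W [pred u | `[< wo_lt v u >]].
case=> [|u [[/asboolP vu umin] _]]; first by exists w; apply/asboolP.
exists u; last first.
  have [->|neq] := pselect (u = w); [by left|right; split=> //].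
  by apply: umin; apply/asboolP.
split=> // x xu; apply: contrapT => /not_orP[nxv neq_xv].
have [//|vx] := wo_lt_total neq_xv.
have ux : wo_le u x by apply: umin; apply/asboolP.
by apply: (wo_lt_asym xu); split=> // uE; case: xu => _; apply.
Qed.

End WellOrders.

(** * Monotonicity of the ranks and the fixed point *)

Section Ranks.
Variables (R : realType) (L : signature R).
Variables (Om : {ptws nat -> R} -> \bar R) (A B : structure L).
Hypotheses (Om_modulus : is_weak_modulus Om) (Om_shift : shift_increasing Om).
Local Open Scope ereal_scope.
Implicit Types r : tuple_pseudodist A B.

Definition le_pseudodist r r' :=
  forall n (a : 'I_n -> A) (b : 'I_n -> B), r n a b <= r' n a b.

(** This invariant is carried along all ranks because dropping the last entry of a tuple is the case
    that makes the ranks nondecreasing. *)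
Definition subtuple_mono r := forall m n (sigma : 'I_m -> 'I_n)
    (a : 'I_n -> A) (b : 'I_n -> B),
  increasing_tuple sigma -> r m (a \o sigma) (b \o sigma) <= r n a b.

Lemma bf_step_mono r r' : le_pseudodist r r' ->
  le_pseudodist (bf_step r) (bf_step r').
Proof.
move=> le_rr' n a b; apply: ge_ereal_sup => _ [cd _ <-].
apply: le_trans; last by apply: ereal_sup_ubound; exists cd.
apply: le_ereal_inf_tmp => _ [cd' _ <-].
apply: le_trans; first by apply: ereal_inf_lbound; exists cd'.
by rewrite ge_max !le_max !le_rr' orbT.
Qed.

(** A formula admissible for the subtuple stays admissible after renaming its variables along
    [sigma], since [Om] is shift-increasing. *)
Lemma bf_zero_subtuple : subtuple_mono (bf_zero Om (A := A) (B := B)).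
Proof.
move=> m n sigma a b sigma_inc; apply: ge_ereal_sup => _ [phi /= phi_mod <-].
apply: ereal_sup_ubound; exists (basic_rename sigma phi).
  move=> delta d0; rewrite basic_mod_rename.
  apply: (le_trans (phi_mod (delta \o sigma) (fun i => d0 (sigma i)))).
  rewrite (_ : delta \o sigma = zero_extend delta \o (val \o sigma)).
    apply: (@trunc_subtuple _ _ _ _ (val \o sigma)) => //.
    exact: zero_extend_ge0.
  by apply/funext => i /=; rewrite zero_extend_lt.
by rewrite !basic_int_rename.
Qed.

Lemma bf_step_subtuple r : subtuple_mono r -> subtuple_mono (bf_step r).
Proof.
move=> r_mono m n sigma a b sigma_inc.
(* The new last index goes to the new last index, so an element appended to the subtuple is the one
   appended to the full tuple. *)
pose sigma1 : 'I_m.+1 -> 'I_n.+1 := tsnoc (lift ord_max \o sigma) ord_max.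
have sigma1_inc : increasing_tuple sigma1.
  move=> i j; rewrite /sigma1.
  case: (unliftP ord_max i) => [i' ->|->]; last by rewrite ltnNge -ltnS ltn_ord.
  rewrite tsnoc_lift lift_max; case: (unliftP ord_max j) => [j' ->|->].
    by rewrite tsnoc_lift !lift_max; exact: sigma_inc.
  by rewrite tsnoc_max lift_max ltn_ord.
have sigma1E T (u : 'I_n -> T) c : tsnoc (u \o sigma) c = tsnoc u c \o sigma1.
  apply/esym/tsnocP => [i|] /=; rewrite /sigma1 ?tsnoc_max//.
  by rewrite tsnoc_lift /= tsnoc_lift.
apply: ge_ereal_sup => _ [cd _ <-].
apply: le_trans; last by apply: ereal_sup_ubound; exists cd.
apply: le_ereal_inf_tmp => _ [cd' _ <-].
apply: le_trans; first by apply: ereal_inf_lbound; exists cd'.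
by rewrite ge_max !le_max !sigma1E !r_mono// orbT.
Qed.

(** Whatever the answer to a challenge, forgetting the appended entries gives back [a] and [b].
    Nonemptiness of both structures provides a challenge. *)
Lemma le_bf_step r : subtuple_mono r -> le_pseudodist r (bf_step r).
Proof.
move=> r_mono n a b; have [c _] := carrier_nonempty A.
have [d _] := carrier_nonempty B.
apply: le_trans; last by apply: ereal_sup_ubound; exists (c, d).
apply: le_ereal_inf_tmp => _ [cd' _ <-]; rewrite le_max; apply/orP; left.
have lift_tsnoc T (u : 'I_n -> T) x : u = tsnoc u x \o lift ord_max.
  by apply/funext => i /=; rewrite tsnoc_lift.
rewrite [X in r _ X _](lift_tsnoc _ _ c) [X in r _ _ X](lift_tsnoc _ _ cd'.2).
by apply: r_mono => i j; rewrite !lift_max.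
Qed.

Variant bf_rank_spec (W : wellOrder) (w : W) : Prop :=
  | BfZero of (forall v, ~ wo_lt v w) &
      bf_rank Om w = bf_zero Om (A := A) (B := B)
  | BfSucc v of wo_succ v w &
      bf_rank Om w = bf_step (bf_rank Om v) :> tuple_pseudodist A B
  | BfLimit of forall n (a : 'I_n -> A) (b : 'I_n -> B),
      bf_rank Om w a b =
      ereal_sup [set bf_rank Om v a b | v in [set v | wo_lt v w]].

Lemma bf_rankP (W : wellOrder) (w : W) : bf_rank_spec w.
Proof.
have [[v vw]|nsucc] := pselect (exists v, wo_succ v w).
  by apply: (BfSucc vw); exact: bf_rankS.
have [v_lt|n_lt] := pselect (exists v, wo_lt v w).
  by apply: BfLimit; apply: bf_rank_limit => // v vw; apply: nsucc; exists v.
have n_lt' v : ~ wo_lt v w by move=> vw; apply: n_lt; exists v.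
by apply: (BfZero n_lt'); exact: bf_rank0.
Qed.

Lemma bf_rank_subtuple (W : wellOrder) (w : W) :
  subtuple_mono (bf_rank Om w).
Proof.
elim/(well_founded_ind (wo_lt_wf (W := W))): w => w IHw.
case: (bf_rankP w) => [_ ->|v [vw _] ->|rankE].
- exact: bf_zero_subtuple.
- exact/bf_step_subtuple/IHw.
move=> m n sigma a b sigma_inc; rewrite !rankE.
apply: ge_ereal_sup => _ [v /= vw <-].
apply: (le_trans (IHw v vw _ _ sigma a b sigma_inc)).
by apply: ereal_sup_ubound; exists v.
Qed.

Lemma bf_rank_mono (W : wellOrder) (u w : W) : wo_lt u w ->
  le_pseudodist (bf_rank Om u) (bf_rank Om w).
Proof.
elim/(well_founded_ind (wo_lt_wf (W := W))): w => w IHw uw.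
case: (bf_rankP w) => [/(_ u)//|v [vw vmax] ->|rankE] n a b.
  apply: le_trans (le_bf_step (@bf_rank_subtuple W v) a b).
  by have [uv|->//] := vmax u uw; exact: IHw.
by rewrite rankE; apply: ereal_sup_ubound; exists u.
Qed.

Lemma bf_zero_le_rank (W : wellOrder) (w : W) :
  le_pseudodist (bf_zero Om (A := A) (B := B)) (bf_rank Om w).
Proof.
elim/(well_founded_ind (wo_lt_wf (W := W))): w => w IHw.
have [[v vw]|n_lt] := pselect (exists v, wo_lt v w); last first.
  by move=> n a b; rewrite bf_rank0// => v vw; apply: n_lt; exists v.
by move=> n a b; apply: le_trans (IHw v vw n a b) (bf_rank_mono vw a b).
Qed.

Lemma bf_rank_le_fixpoint r (W : wellOrder) (w : W) :
  le_pseudodist (bf_zero Om (A := A) (B := B)) r ->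
  le_pseudodist (bf_step r) r -> le_pseudodist (bf_rank Om w) r.
Proof.
move=> le_zero le_step.
elim/(well_founded_ind (wo_lt_wf (W := W))): w => w IHw.
case: (bf_rankP w) => [_ ->//|v [vw _] ->|rankE] n a b.
  exact: le_trans (bf_step_mono (IHw v vw) a b) (le_step n a b).
by rewrite rankE; apply: ge_ereal_sup => _ [v /= vw <-]; exact: IHw.
Qed.

Lemma bf_infty_le r :
  le_pseudodist (bf_zero Om (A := A) (B := B)) r ->
  le_pseudodist (bf_step r) r ->
  le_pseudodist (bf_infty Om (A := A) (B := B)) r.
Proof.
move=> le_zero le_step n a b; apply: ge_ereal_sup => _ [W [w ->]].
exact: bf_rank_le_fixpoint.
Qed.

(** Cantor's diagonal: [D] collects the values [f S] that lie outside [S]. *)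
Lemma cantor_no_injection (X : Type) (f : set X -> X) : ~ injective f.
Proof.
move=> f_inj; pose D : set X := [set x | exists2 S, x = f S & ~ S x].
have nD : ~ D (f D) by move=> DfD; have [S /f_inj <-] := DfD; apply.
by apply: (nD); exists D.
Qed.

(** The power set of all pseudo-distances, once well-ordered, is too long for [bf_rank] to be
    injective. If two ranks [u' < v'] agree, the successor of [u'] lies at or below [v'], so its
    rank is squeezed between them. *)
Lemma bf_rank_stalls : exists (W : wellOrder) (w : W),
  le_pseudodist (bf_step (bf_rank Om w)) (bf_rank Om w : tuple_pseudodist A B).
Proof.
pose T := {classic (set (tuple_pseudodist A B))}.
have [le_T le_TP] := wochoice.well_ordering_principle T.
pose W := WellOrder le_TP.
have : ~ injective (@bf_rank R L Om A B W).
  exact: cantor_no_injection.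
move=> /existsNP[u /existsNP[v /not_implyP[rank_uv neq_uv]]].
have [u' [v' [uv' rank_uv']]] : exists u' v' : W, wo_lt u' v' /\
    bf_rank Om u' = bf_rank Om v' :> tuple_pseudodist A B.
  by have [uv|vu] := wo_lt_total neq_uv; [exists u, v|exists v, u].
exists W, u'; have [u1 u1_succ u1_le] := wo_succ_exists uv'.
rewrite -(bf_rankS _ _ _ u1_succ) rank_uv'.
by case: u1_le => [->//|/bf_rank_mono].
Qed.

(** A stalled rank is above [bf_zero] and closed under the step, so it dominates [bf_infty] by
    minimality; conversely [bf_infty] dominates every rank. *)
Lemma bf_infty_fixpoint :
  let r := bf_infty Om (A := A) (B := B) in
  le_pseudodist (bf_zero Om (A := A) (B := B)) r /\
  le_pseudodist (bf_step r) r.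
Proof.
move=> r; have [W [w step_w]] := bf_rank_stalls.
have le_infty (W' : wellOrder) (w' : W') :
    le_pseudodist (bf_rank Om w') r.
  by move=> n a b; apply: ereal_sup_ubound; exists W', w'.
have zero_w := @bf_zero_le_rank W w.
split=> n a b; first exact: le_trans (zero_w n a b) (le_infty W w n a b).
apply: le_trans (le_infty W w n a b); apply: le_trans (step_w n a b).
exact: bf_step_mono (bf_infty_le zero_w step_w) _ _ _.
Qed.

End Ranks.

(** * Upper bound from an isomorphism *)

Section UpperBound.
Variables (R : realType) (L : signature R).
Variables (Om : {ptws nat -> R} -> \bar R) (A B : structure L) (f : A -> B).
Hypothesis f_iso : isomorphism f.
Local Open Scope ereal_scope.

Lemma tuple_dist_snoc (X : metricType R) n (a b : 'I_n -> X) c :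
  tuple_dist Om (tsnoc a c) (tsnoc b c) = tuple_dist Om a b.
Proof.
rewrite /tuple_dist /trunc -[in RHS]zero_extend_snoc0.
congr (Om (zero_extend _)).
by apply: tsnocP => [i|]; rewrite ?tsnoc_lift// !tsnoc_max mdistxx.
Qed.

Lemma bf_infty_le_iso n (a : 'I_n -> A) (b : 'I_n -> B) :
  bf_infty Om a b <= tuple_dist Om (f \o a) b.
Proof.
pose r : tuple_pseudodist A B := fun n a b => tuple_dist Om (f \o a) b.
apply: (@bf_infty_le _ _ _ _ _ r) => {n a b} n a b.
  apply: ge_ereal_sup => _ [phi /= phi_mod <-].
  (* Transport along [f] puts both values in [B], where the modulus of [phi] compares them. *)
  rewrite -(basic_int_iso f_iso); apply: le_trans (basic_int_dist _ _ _) _.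
  by apply: phi_mod => i; exact: mdist_ge0.
have [[g fgK gfK] _ _] := f_iso.
apply: ge_ereal_sup => _ [[c d] _ <-].
apply: ereal_inf_le; exists (maxe (r n.+1 (tsnoc a c) (tsnoc b (f c)))
  (r n.+1 (tsnoc a (g d)) (tsnoc b d))).
  by exists (g d, f c).
by rewrite /r !comp_tsnoc gfK !tuple_dist_snoc maxxx.
Qed.

End UpperBound.

(** * Formulas with modulus controlled by [Om] *)

Section Formulas.
Variables (R : realType) (L : signature R).

Definition dist_atom n (t u : term L n) : atomic L n :=
  @Atomic R L n Dist (fun i : 'I_2 => if i == ord0 then t else u).

Lemma atom_int_dist_atom (A : structure L) n (t u : term L n) (a : 'I_n -> A) :
  atom_int (dist_atom t u) a = mdist (term_int t a) (term_int u a).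
Proof. by []. Qed.

Variable Om : {ptws nat -> R} -> \bar R.
Hypothesis Om_univ : universal_weak_modulus L Om.

Let Om_modulus : is_weak_modulus Om. Proof. by case: Om_univ. Qed.
Let Om_shift : shift_increasing Om. Proof. by case: Om_univ. Qed.

(** Indices of at least [q] leave the positions below [q] free for the leading zeros. This is how
    the padding allowed by a universal weak modulus is absorbed by going far along a sequence. *)
Lemma trunc_tcat0_le q m (sigma : 'I_m -> nat) (delta : nat -> R) :
  increasing_tuple sigma -> (forall i, (q <= sigma i)%N) -> orthant nat delta ->
  (trunc Om (tcat (fun _ : 'I_q => 0%R) (delta \o sigma)) <= Om delta)%E.
Proof.
move=> sigma_inc le_q d0.
pose sigma1 : 'I_(q + m) -> nat := tcat (@nat_of_ord q) sigma.
apply: (@le_trans _ _ (trunc Om (delta \o sigma1))).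
  apply: trunc_mono => // i; rewrite /= /sigma1 /tcat.
    by case: fintype.split => j //=.
  by case: fintype.split => j //=.
apply: trunc_subtuple => //; apply: tcat_increasing => // i j.
exact: leq_trans (ltn_ord i) (le_q j).
Qed.

(** One run of leading zeros bounds the atomic modulus by [Om], a second one absorbs the factor [M];
    the two runs concatenate. *)
Lemma atom_mod_scaled m (phi : atomic L m) (M : R) : 0 < M ->
  exists N, forall delta, orthant 'I_m delta ->
    ((M * atom_mod phi delta)%:E <=
     trunc Om (tcat (fun _ : 'I_N => 0%R) delta))%E.
Proof.
move=> M0; have [_ /(_ _ phi)[p phi_p] + _ _] := Om_univ.
move=> /(_ (p + m)%N M M0)[q Om_q]; exists (q + p)%N => delta d0.
have cat0 : orthant 'I_(p + m) (tcat (fun _ : 'I_p => 0%R) delta).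
  by move=> i; rewrite /tcat; case: fintype.split.
rewrite EFinM; apply: le_trans (lee_wpmul2l _ (phi_p _ d0)) _.
  by rewrite lee_fin ltW.
apply: le_trans (Om_q _ cat0) _; rewrite /trunc le_eqVlt; apply/orP; left.
apply/eqP; congr Om; apply/funext => i; rewrite !zero_extend_tcat.
have ze0 j t : zero_extend (fun _ : 'I_j => 0 : R) t = 0.
  by rewrite /zero_extend; case: insub.
rewrite !ze0 subnDA; case: (ltnP i q) => [lt_iq|le_qi].
  by rewrite (leq_trans lt_iq) ?leq_addr.
by rewrite ltn_subLR.
Qed.

Lemma atom_mod_small m (phi : atomic L m) (e : R) : 0 < e ->
  exists2 eta : R, 0 < eta & forall delta, orthant 'I_m delta ->
    (forall i, delta i <= eta) -> atom_mod phi delta <= e.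
Proof.
move=> e0; have [_ /(_ _ phi)[p phi_p] _ _ _] := Om_univ.
have [eta eta0 eta_small] := trunc_small Om_modulus (p + m) e0.
exists eta => // delta d0 le_d; rewrite -lee_fin.
apply: le_trans (phi_p _ d0) (eta_small _ _ _) => i; rewrite /tcat.
  by case: fintype.split.
by case: fintype.split => j //; exact: ltW.
Qed.

Definition scaled_atom n (M : R) (phi : atomic L n) : basic L n :=
  @Basic R L n 1 (fun=> phi) (fun x => M * x ord0)
    (continuous_subspaceT (@scale_coord_continuous R 1 M ord0)).

Lemma scaled_atom_mod n (M : R) (phi : atomic L n) delta : 0 < M ->
  (basic_mod (scaled_atom M phi) delta <= (M * atom_mod phi delta)%:E)%E.
Proof.
move=> M0; apply: ge_ereal_sup => _ [x [y [_ _ /(_ ord0) le_xy ->]]] /=.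
by rewrite lee_fin -mulrBr normrM gtr0_norm// ler_pM2l.
Qed.

(* The formula [Om|_k (d(x_(sigma i), x_(tau i)))_i]. The positive parts are
   needed because the bound of d may contain negative numbers. *)
Definition dist_formula k n (sigma tau : 'I_k -> 'I_n) : basic L n :=
  @Basic R L n k (fun i => dist_atom (Var L (sigma i)) (Var L (tau i)))
    (fun x => fine (trunc Om (fun i => Num.max (x i) 0)))
    (continuous_subspaceT (@trunc_pos_part_continuous R k Om Om_modulus)).

Lemma dist_formula_int (A : structure L) k n (sigma tau : 'I_k -> 'I_n)
    (a : 'I_n -> A) :
  basic_int (dist_formula sigma tau) a =
  fine (tuple_dist Om (a \o sigma) (a \o tau)).
Proof.
rewrite /basic_int /=; congr (fine (trunc Om _)); apply/funext => i.
by rewrite atom_int_dist_atom /= max_l// mdist_ge0.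
Qed.

(** The atoms vary by at most [delta (sigma i) + delta (tau i)]. Subadditivity splits this into two
    [Om] terms, and superadditivity merges them over the concatenation of [sigma] and [tau], which
    is increasing because [sigma] lies before [tau]. *)
Lemma dist_formula_mod k n (sigma tau : 'I_k -> 'I_n) (delta : 'I_n -> R) :
  increasing_tuple sigma -> increasing_tuple tau ->
  (forall i j, (sigma i < tau j)%N) -> orthant 'I_n delta ->
  (basic_mod (dist_formula sigma tau) delta <= trunc Om delta)%E.
Proof.
move=> sigma_inc tau_inc sigma_tau d0.
apply: ge_ereal_sup => _ [x [y [_ _ le_xy ->]]] /=.
apply: le_trans (trunc_pos_part_dist Om_modulus _ _) _.
have ds0 : orthant 'I_k (delta \o sigma) by move=> i; exact: (d0 (sigma i)).
have dt0 : orthant 'I_k (delta \o tau) by move=> i; exact: (d0 (tau i)).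
apply: (@le_trans _ _
  (trunc Om (fun i => (delta \o sigma) i + (delta \o tau) i))).
  by apply: trunc_mono => // i; exact: normr_ge0.
apply: le_trans (trunc_leD Om_modulus ds0 dt0) _.
have [_ _ _ Om_super _] := Om_univ.
apply: le_trans (Om_super _ _ _ _ ds0 dt0) _.
rewrite -comp_tcat.
have -> : delta \o tcat sigma tau =
    zero_extend delta \o tcat (val \o sigma) (val \o tau).
  by rewrite -comp_tcat; apply/funext => i /=; rewrite zero_extend_lt.
apply: trunc_subtuple => //; last exact: zero_extend_ge0.
exact: tcat_increasing.
Qed.

End Formulas.

(** * Back-and-forth sequences and their limits *)

(** Stage [m] fixes the first [k + m] entries. As [G n] reads only the first [n] entries, it passes
    from the stages to their limit. *)
Lemma dependent_extension (T : Type) (G : nat -> (nat -> T) -> Prop)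
    (Q : nat -> T -> Prop) k u0 :
  (forall n u u', (forall i, (i < n)%N -> u i = u' i) -> G n u -> G n u') ->
  G k u0 ->
  (forall n u, G n u ->
     exists x, Q n x /\ G n.+1 (fun i => if i == n then x else u i)) ->
  exists u, (forall i, (i < k)%N -> u i = u0 i) /\
    forall n, (k <= n)%N -> G n u /\ Q n (u n).
Proof.
move=> G_ext G0 G_step.
have /choice[next nextP] : forall nu : nat * (nat -> T), exists x,
    G nu.1 nu.2 ->
    Q nu.1 x /\ G nu.1.+1 (fun i => if i == nu.1 then x else nu.2 i).
  move=> [n u]; have [/G_step[x xP]|nG] := pselect (G n u); first by exists x.
  by exists (u 0).
pose st := fix st m := if m is m'.+1 then
  fun i => if i == (k + m')%N then next ((k + m')%N, st m') else st m' i
  else u0.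
have G_st m : G (k + m)%N (st m).
  elim: m => [|m IHm]; first by rewrite addn0.
  by rewrite addnS; have [] := nextP (_, _) IHm.
(* The first stage at which entry [i] is final; truncated subtraction gives stage 0 when [i < k]. *)
pose u i := st (i.+1 - k)%N i.
have uE m i : (i < k + m)%N -> u i = st m i.
  elim: m => [|m IHm]; first by rewrite addn0 /u -subn_eq0 => /eqP ->.
  rewrite addnS ltnS leq_eqVlt => /predU1P[->|lt_ikm].
    by rewrite /u -addnS addKn.
  by rewrite IHm//= ltn_eqF.
exists u; split=> [i lt_ik|n le_kn]; first by rewrite (uE 0%N)// addn0.
rewrite -(subnKC le_kn); move: (n - k)%N => m; split.
  by apply: G_ext (G_st m) => i /uE.
rewrite (uE m.+1) ?addnS//= eqxx.
by have [] := nextP (_, _) (G_st m).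
Qed.

Section Enumeration.
Variables (R : realType) (L : signature R) (A : structure L).

Definition visits_densely (a : nat -> A) := forall x (e : R) N, 0 < e ->
  exists2 n, (N <= n)%N & mdist x (a n) < e.

Lemma separable_enumeration : separable A -> exists e : nat -> A,
  forall x (eps : R) N (p : bool), 0 < eps ->
    exists2 n, (N <= n)%N & odd n = p /\ mdist x (e n) < eps.
Proof.
move=> [D /countable_injP[c c_inj] D_dense].
have [x0 _] := carrier_nonempty A.
pose e0 i := xget x0 [set x | D x /\ c x = i].
exists (fun n => e0 (logn 2 n./2)) => x eps N p eps0.
have [|y [xy Dy]] := D_dense (interior (ball x eps)) _ (@open_interior _ _).
  by exists x; apply: nbhsx_ballx.
(* This has valuation [c y] and is at least [N]; doubling it and adding [p] sets the parity. *)
pose n := (2 ^ c y * N.*2.+1)%N.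
have le_Nn : (N <= n)%N.
  rewrite /n -[N]mul1n leq_mul ?expn_gt0// mul1n -addnn.
  by rewrite -addSn leq_addl.
exists (p + n.*2)%N; first by rewrite -addnn; lia.
split; first by rewrite oddD odd_double oddb addbF.
have -> : e0 (logn 2 (p + n.*2)./2) = y.
  rewrite half_bit_double /n lognM ?expn_gt0// pfactorK//.
  rewrite (lognE 2 _.+1) dvdn2/= odd_double/= addn0.
  have [] : [set x | D x /\ c x = c y] (e0 (c y)) by apply: xgetPex; exists y.
  by move=> Dz cz; apply: c_inj => //; rewrite inE.
by move/interior_subset : xy; rewrite ballEmdist.
Qed.

End Enumeration.

Section BackAndForthSequences.
Variables (R : realType) (L : signature R) (A B : structure L).
Local Open Scope ereal_scope.

(** A strict bound on the infimum provides an actual answer. Only half of a challenge pair is used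
    each time, the other half being an arbitrary point. *)
Lemma back_and_forth_step (r : tuple_pseudodist A B) (s : \bar R) n
    (a : 'I_n -> A) (b : 'I_n -> B) :
  le_pseudodist (bf_step r) r -> r n a b < s ->
  (forall c, exists d, r n.+1 (tsnoc a c) (tsnoc b d) < s) /\
  (forall d, exists c, r n.+1 (tsnoc a c) (tsnoc b d) < s).
Proof.
move=> r_step rab.
have step c d : exists cd' : A * B, maxe (r n.+1 (tsnoc a c) (tsnoc b cd'.2))
    (r n.+1 (tsnoc a cd'.1) (tsnoc b d)) < s.
  have : ereal_inf [set maxe (r n.+1 (tsnoc a c) (tsnoc b cd'.2))
      (r n.+1 (tsnoc a cd'.1) (tsnoc b d)) | cd' in [set: A * B]] < s.
    apply: le_lt_trans rab; apply: le_trans (r_step _ _ _).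
    by apply: ereal_sup_ubound; exists (c, d).
  by move=> /ereal_inf_lt[_ [cd' _ <-] lt_s]; exists cd'.
have [c0 _] := carrier_nonempty A; have [d0 _] := carrier_nonempty B.
split=> [c|d].
  by have [cd'] := step c d0; rewrite gt_max => /andP[+ _]; exists cd'.2.
by have [cd'] := step c0 d; rewrite gt_max => /andP[_]; exists cd'.1.
Qed.

Lemma back_and_forth_sequences (r : tuple_pseudodist A B) (s : \bar R) k
    (v : 'I_k -> A) (w : 'I_k -> B) :
  le_pseudodist (bf_step r) r -> r k v w < s -> separable A -> separable B ->
  exists (a : nat -> A) (b : nat -> B),
  [/\ (forall i : 'I_k, a i = v i /\ b i = w i),
      visits_densely a, visits_densely b &
      forall n, (k <= n)%N ->
        r n (fun i : 'I_n => a i) (fun i : 'I_n => b i) < s].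
Proof.
move=> r_step rvw /separable_enumeration[eA eA_dense].
move=> /separable_enumeration[eB eB_dense].
have [c0 _] := carrier_nonempty A; have [d0 _] := carrier_nonempty B.
pose G n (u : nat -> A * B) :=
  r n (fun i : 'I_n => (u i).1) (fun i : 'I_n => (u i).2) < s.
pose Q n (x : A * B) := if odd n then x.1 = eA n else x.2 = eB n.
pose u0 i := if insub i is Some j then (v j, w j) else (c0, d0).
have u0E (i : 'I_k) : u0 i = (v i, w i) by rewrite /u0 valK.
have [n u u' uu' Gu||n u Gu|u [u_u0 uP]] := @dependent_extension _ G Q k u0.
- rewrite /G; under eq_fun do rewrite -uu'//.
  by under [X in r _ _ X]eq_fun do rewrite -uu'//.
- rewrite /G; under eq_fun do rewrite u0E.
  by under [X in r _ _ X]eq_fun do rewrite u0E.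
- have snocE C (p : A * B -> C) x : (fun i : 'I_n.+1 =>
      p (if i == n :> nat then x else u i)) =
      tsnoc (fun i : 'I_n => p (u i)) (p x).
    by apply: tsnocP => [i|]; rewrite ?lift_max ?eqxx// ltn_eqF.
  have [step1 step2] := back_and_forth_step r_step Gu.
  (* Odd steps prescribe the point of [A] and answer in [B]; even steps do the reverse. *)
  case n_odd : (odd n).
    have [d rd] := step1 (eA n); exists (eA n, d); rewrite /Q n_odd; split=> //.
    by rewrite /G (snocE _ fst) (snocE _ snd).
  have [c rc] := step2 (eB n); exists (c, eB n); rewrite /Q n_odd; split=> //.
  by rewrite /G (snocE _ fst) (snocE _ snd).
exists (fst \o u), (snd \o u); split=> [i|x e N e0|x e N e0|n /uP[]//].
- by rewrite /= u_u0// u0E.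
- have [n le_n [n_odd en]] := eA_dense x e (maxn k N) true e0.
  rewrite geq_max in le_n; case/andP: le_n => /uP[_ +] le_Nn.
  by rewrite /Q n_odd => un; exists n; rewrite //= un.
- have [n le_n [n_odd en]] := eB_dense x e (maxn k N) false e0.
  rewrite geq_max in le_n; case/andP: le_n => /uP[_ +] le_Nn.
  by rewrite /Q n_odd => un; exists n; rewrite //= un.
Qed.

End BackAndForthSequences.

Section Limits.
Variables (R : realType) (L : signature R).

Definition asymptotic (A B : structure L) (a : nat -> A) (b : nat -> B) :=
  forall m (phi : atomic L m) (e : R), 0 < e ->
  exists N, forall j : 'I_m -> nat, increasing_tuple j ->
    (forall i, (N <= j i)%N) ->
    `|atom_int phi (a \o j) - atom_int phi (b \o j)| <= e.

Definition cluster_pair (A B : structure L) (a : nat -> A) (b : nat -> B) x y :=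
  forall (e : R) N, 0 < e ->
    exists2 n, (N <= n)%N & mdist x (a n) < e /\ mdist y (b n) < e.

Lemma asymptotic_sym (A B : structure L) (a : nat -> A) (b : nat -> B) :
  asymptotic a b -> asymptotic b a.
Proof.
move=> ab m phi e /(ab _ phi)[N abN]; exists N => j j_inc le_N.
by rewrite distrC; exact: abN.
Qed.

Lemma asymptotic_mdist (A B : structure L) (a : nat -> A) (b : nat -> B)
    (e : R) :
  asymptotic a b -> 0 < e -> exists N, forall p q, (N <= p)%N -> (p < q)%N ->
    `|mdist (a p) (a q) - mdist (b p) (b q)| <= e.
Proof.
move=> ab e0.
have [N abN] := ab _ (dist_atom (Var L (ord0 : 'I_2)) (Var L ord_max)) e e0.
exists N => p q le_Np lt_pq.
apply: (abN (fun i => if i == ord0 then p else q)) => [i j|i].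
  by case: i => -[|[|//]] ?; case: j => -[|[|//]] ?.
by case: ifP => // _; rewrite (leq_trans le_Np)// ltnW.
Qed.

(** Along indices [n i] with [a (n i)] tending to [x], asymptotic equality of distances makes
    [b (n i)] Cauchy; completeness of [B] gives its limit. *)
Lemma cluster_pair_exists (A B : structure L) (a : nat -> A) (b : nat -> B) :
  asymptotic a b -> visits_densely a ->
  forall x, exists y, cluster_pair a b x y.
Proof.
move=> ab a_dense x.
have /choice[n nP] : forall i : nat,
    exists n, (i <= n)%N /\ mdist x (a n) < i.+1%:R^-1.
  move=> i; have [|n] := a_dense x (i.+1%:R^-1) i; first by rewrite invr_gt0.
  by exists n.
have near_inv (e : R) : 0 < e ->
    exists I, forall i, (I <= i)%N -> i.+1%:R^-1 < e.
  move=> e0; have [I _ IP] := near_infty_natSinv_lt (PosNum e0).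
  by exists I => i /IP.
have b_cauchy : cauchy (b \o n @ \oo).
  apply: cauchy_exP => e e0.
  have e40 : 0 < e / 4 by rewrite divr_gt0.
  have [N abN] := asymptotic_mdist ab e40.
  have [I IP] := near_inv _ e40.
  (* Since [n i >= i], every [i > p] has [p < n i], as the asymptotic estimate requires. *)
  pose p := n (maxn N I); exists (b p).
  exists p.+1 => //= i lt_pi; rewrite ballEmdist /=.
  have le_Np : (maxn N I <= p)%N by have [] := nP (maxn N I).
  have lt_pn : (p < n i)%N by have [] := nP i => + _; exact: leq_trans.
  have := abN p (n i) (leq_trans (leq_maxl _ _) le_Np) lt_pn.
  have dp : mdist x (a p) < e / 4.
    have [_] := nP (maxn N I); move/lt_trans; apply; apply: IP.
    exact: leq_maxr.
  have di : mdist x (a (n i)) < e / 4.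
    have [_] := nP i; move/lt_trans; apply; apply: IP.
    by rewrite (leq_trans _ (ltnW lt_pi))// (leq_trans (leq_maxr N I)).
  have := metric_triangle (a p) x (a (n i)); rewrite (metric_sym (a p) x).
  by rewrite ler_distl => ? /andP[? ?]; lra.
have [y y_lim] := carrier_complete (F := b \o n @ \oo) _ b_cauchy.
exists y => e N e0; have [I IP] := near_inv _ e0.
have [J _ JP] := metricType_numDomainType.cvgr_dist_lt y_lim e0.
pose i := maxn (maxn I J) N; have [le_i di] := nP i.
exists (n i); first by rewrite (leq_trans _ le_i)// leq_maxr.
split; last by apply: JP => /=; rewrite /i -maxnA maxnCA leq_maxl.
by apply: lt_trans di _; apply: IP; rewrite /i -maxnA leq_maxl.
Qed.

Variable Om : {ptws nat -> R} -> \bar R.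
Hypothesis Om_univ : universal_weak_modulus L Om.

Lemma atom_int_close (A : structure L) m (phi : atomic L m) (e : R) : 0 < e ->
  exists2 eta : R, 0 < eta & forall x y : 'I_m -> A,
    (forall i, mdist (x i) (y i) < eta) ->
    `|atom_int phi x - atom_int phi y| <= e.
Proof.
move=> /(atom_mod_small Om_univ phi)[eta eta0 eta_small].
exists eta => // x y le_xy; apply: le_trans (atom_int_dist _ _ _) _.
by apply: eta_small => i; [exact: mdist_ge0|exact: ltW].
Qed.

Section Graph.
Variables (A B : structure L) (a : nat -> A) (b : nat -> B).
Hypothesis ab : asymptotic a b.

(** All pairs [(x i, y i)] are approximated at common increasing indices [j]: two errors come from
    uniform continuity, the third from [asymptotic]. *)
Lemma atom_int_cluster m (phi : atomic L m) (x : 'I_m -> A) (y : 'I_m -> B) :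
  (forall i, cluster_pair a b (x i) (y i)) -> atom_int phi x = atom_int phi y.
Proof.
move=> xy; apply/eqP; rewrite -subr_eq0 -normr_le0.
apply/ler_addgt0Pr => e e0; rewrite add0r.
have e30 : 0 < e / 3 by rewrite divr_gt0.
have [etaA etaA0 closeA] := @atom_int_close A _ phi _ e30.
have [etaB etaB0 closeB] := @atom_int_close B _ phi _ e30.
have [N abN] := ab phi e30.
have eta0 : 0 < Num.min etaA etaB by rewrite lt_min etaA0.
have [j [j_inc le_N j_close]] := increasing_choice (fun i M => xy i _ M eta0) N.
have dA : `|atom_int phi x - atom_int phi (a \o j)| <= e / 3.
  by apply: closeA => i; have [+ _] := j_close i; rewrite lt_min => /andP[].
have dB : `|atom_int phi y - atom_int phi (b \o j)| <= e / 3.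
  by apply: closeB => i; have [_] := j_close i; rewrite lt_min => /andP[].
have := abN j j_inc le_N; move: dA dB.
by rewrite !ler_norml => /andP[? ?] /andP[? ?] /andP[? ?]; apply/andP; lra.
Qed.

Lemma mdist_cluster x y x' y' :
  cluster_pair a b x y -> cluster_pair a b x' y' -> mdist x x' = mdist y y'.
Proof.
move=> xy xy'.
apply: (atom_int_cluster (dist_atom (Var L (ord0 : 'I_2)) (Var L ord_max))
  (x := fun i => if i == ord0 then x else x')
  (y := fun i => if i == ord0 then y else y')) => i.
by case: ifP.
Qed.

Lemma cluster_isomorphism : visits_densely a -> visits_densely b ->
  exists2 f : A -> B, isomorphism f & forall x, cluster_pair a b x (f x).
Proof.
move=> a_dense b_dense.
have /choice[f fP] := cluster_pair_exists ab a_dense.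
have /choice[g gP] : forall y, exists x, cluster_pair a b x y.
  move=> y; have [x xy] := cluster_pair_exists (asymptotic_sym ab) b_dense y.
  by exists x => e N /(xy e N)[n ? []]; exists n.
exists f => //; split.
(* The cluster relation preserves distances, so pairs sharing one coordinate also share the
   other. *)
- exists g => [x|y]; apply: mdist_positivity.
    by rewrite (mdist_cluster (gP (f x)) (fP x)) mdistxx.
  by rewrite -(mdist_cluster (fP (g y)) (gP y)) mdistxx.
- move=> F x; apply/mdist_positivity; rewrite metric_sym.
  (* Function symbols are handled by the formula [d(F(x_0, ...), x_n)], with [n] the arity of [F]:
     its value 0 at [x] followed by [fint x] carries over to the images under [f]. *)
  pose phi : atomic L (farity F).+1 :=
    dist_atom (App (fun j => Var L (lift ord_max j))) (Var L ord_max).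
  have phiE (C : structure L) (t : 'I_(farity F) -> C) c :
      atom_int phi (tsnoc t c) = mdist (fint t) c.
    rewrite atom_int_dist_atom /= tsnoc_max; congr (mdist (fint _) _).
    by apply/funext => j; rewrite tsnoc_lift.
  rewrite -(phiE B) -(comp_tsnoc f).
  rewrite -(atom_int_cluster phi (x := tsnoc x (fint x))).
    by rewrite phiE mdistxx.
  by move=> i; exact: fP.
- move=> P x.
  by have := atom_int_cluster (Atomic (fun j => Var L j)) (fun i => fP (x i)).
Qed.

End Graph.

Variables (A B : structure L) (k : nat) (s : R) (a : nat -> A) (b : nat -> B).
Hypothesis zero_le : forall n, (k <= n)%N ->
  (bf_zero Om (fun i : 'I_n => a i) (fun i : 'I_n => b i) <= s%:E)%E.

Lemma basic_int_le n (phi : basic L n) : (k <= n)%N ->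
  (forall delta : 'I_n -> R, orthant 'I_n delta ->
    (basic_mod phi delta <= trunc Om delta)%E) ->
  `|basic_int phi (fun i : 'I_n => a i) -
    basic_int phi (fun i : 'I_n => b i)| <= s.
Proof.
move=> /zero_le le_s phi_mod; rewrite -lee_fin; apply: le_trans le_s.
by apply: ereal_sup_ubound; exists phi.
Qed.

(* Conditions (1) and (2) on [Om] let a formula applied far enough along the
   sequences be scaled by any constant [M], so that it varies by at most
   [s / M] between [a] and [b]. *)
Lemma bf_zero_asymptotic : asymptotic a b.
Proof.
have [Om_modulus _ _ _ Om_shift] := Om_univ.
move=> m phi e e0; pose M := `|s| / e + 1.
have M0 : 0 < M by rewrite ltr_wpDl// divr_ge0// ltW.
have [N phiN] := atom_mod_scaled Om_univ phi M0.
exists N => j j_inc le_N.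
pose n := maxn k (\max_i j i).+1.
have j_lt i : (j i < n)%N by rewrite leq_max ltnS leq_bigmax orbT.
pose sigma i := Ordinal (j_lt i).
have := @basic_int_le n (scaled_atom M (atom_rename sigma phi)) (leq_maxl _ _).
rewrite /basic_int /= !atom_int_rename -mulrBr normrM (gtr0_norm M0).
move=> scaled_le.
have : M * `|atom_int phi (a \o j) - atom_int phi (b \o j)| <= s.
  apply: scaled_le => delta d0; apply: le_trans (scaled_atom_mod _ _ M0) _.
  rewrite atom_mod_rename.
  have ds0 : orthant 'I_m (delta \o sigma) by move=> i; exact: (d0 (sigma i)).
  apply: le_trans (phiN _ ds0) _.
  have -> : delta \o sigma = zero_extend delta \o j.
    by apply/funext => i /=; rewrite -(zero_extend_lt delta (sigma i)).
  by apply: (trunc_tcat0_le Om_univ) => //; exact: zero_extend_ge0.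
rewrite mulrC -ler_pdivlMr// => /le_trans; apply.
rewrite ler_pdivrMr// (le_trans (ler_norm _))// /M mulrDr mulr1 mulrCA.
rewrite divff ?gt_eqF//.
by rewrite mulr1 lerDl ltW.
Qed.

(** Apply the hypothesis on [bf_zero] to [dist_formula], admissible because every [j i] lies beyond
    the first [k] positions. *)
Lemma tuple_dist_shift (j : 'I_k -> nat) :
  increasing_tuple j -> (forall i, (k <= j i)%N) ->
  (tuple_dist Om (fun i : 'I_k => b i) (b \o j) <=
   s%:E + tuple_dist Om (fun i : 'I_k => a i) (a \o j))%E.
Proof.
have [Om_modulus _ _ _ _] := Om_univ.
move=> j_inc le_k; pose n := maxn k (\max_i j i).+1.
have j_lt i : (j i < n)%N by rewrite leq_max ltnS leq_bigmax orbT.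
pose tau i := Ordinal (j_lt i).
pose sigma : 'I_k -> 'I_n := widen_ord (leq_maxl _ _).
have := @basic_int_le n (dist_formula Om_univ sigma tau) (leq_maxl _ _).
rewrite !dist_formula_int => dist_le.
have fin (X : metricType R) (x y : 'I_k -> X) : tuple_dist Om x y \is a fin_num.
  by apply: trunc_fin_num => // i; exact: mdist_ge0.
rewrite -[leLHS]fineK// -[X in (_ <= _ + X)%E]fineK// -EFinD lee_fin.
have : `|fine (tuple_dist Om (fun i : 'I_k => a i) (a \o j)) -
    fine (tuple_dist Om (fun i : 'I_k => b i) (b \o j))| <= s.
  apply: dist_le => delta; apply: dist_formula_mod => // i i' /=.
  exact: leq_trans (ltn_ord i) (le_k i').
by rewrite distrC ler_distl => /andP[_]; rewrite addrC.
Qed.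

Lemma sequences_isomorphism : visits_densely a -> visits_densely b ->
  exists2 f : A -> B, isomorphism f &
    (tuple_dist Om (f \o (fun i : 'I_k => a i)) (fun i : 'I_k => b i) <=
     s%:E)%E.
Proof.
have [Om_modulus _ _ _ _] := Om_univ.
move=> a_dense b_dense.
have [f f_iso f_cluster] :=
  cluster_isomorphism bf_zero_asymptotic a_dense b_dense.
exists f => //; apply/lee_addgt0Pr => e e0.
have e20 : 0 < e / 2 by rewrite divr_gt0.
have [eta eta0 eta_small] := trunc_small Om_modulus k e20.
have [j [j_inc le_k j_close]] :=
  increasing_choice (fun (i : 'I_k) M => f_cluster (a i) _ M eta0) k.
have dist0 (X : metricType R) (x y : 'I_k -> X) :
    orthant 'I_k (fun i => mdist (x i) (y i)).
  by move=> i; exact: mdist_ge0.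
pose dA := tuple_dist Om (fun i : 'I_k => a i) (a \o j).
pose dB := tuple_dist Om (f \o (fun i : 'I_k => a i)) (b \o j).
have dA_small : (dA <= (e / 2)%:E)%E.
  by apply: eta_small => // i; have [/ltW] := j_close i.
have dB_small : (dB <= (e / 2)%:E)%E.
  by apply: eta_small => // i; have [_ /ltW] := j_close i.
(* Triangle inequality through [b \o j], close to the image of the initial tuple; [tuple_dist_shift]
   then trades the other distance for the small [dA], at cost [s]. *)
apply: (@le_trans _ _ (tuple_dist Om (fun i : 'I_k => b i) (b \o j) + dB)%E).
  apply: le_trans _ (trunc_leD Om_modulus _ _) => //.
  apply: trunc_mono => // i; rewrite /= addrC.
  by rewrite (metric_sym (b i)); exact: metric_triangle.
apply: le_trans (leeD (tuple_dist_shift j_inc le_k) dB_small) _.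
by rewrite -addeA leeD2l// [e in leRHS]splitr EFinD leeD.
Qed.

End Limits.

(** * The formula for the limit pseudo-distance *)

Lemma bf_inftyE (R : realType) (L : signature R)
    (Om : {ptws nat -> R} -> \bar R) (A B : structure L)
    (k : nat) (v : 'I_k -> A) (w : 'I_k -> B) :
  universal_weak_modulus L Om -> separable A -> separable B ->
  bf_infty Om v w = ereal_inf
    [set tuple_dist Om (f \o v) w | f in [set f : A -> B | isomorphism f]].
Proof.
move=> Om_univ A_sep B_sep; have [Om_modulus _ _ _ Om_shift] := Om_univ.
apply/eqP; rewrite eq_le; apply/andP; split.
  by apply: le_ereal_inf_tmp => _ [f f_iso <-]; exact: bf_infty_le_iso.
have [zero_le step_le] := @bf_infty_fixpoint _ _ _ A B Om_modulus Om_shift.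
have inf_le s : (bf_infty Om v w < s%:E)%E -> (ereal_inf
    [set tuple_dist Om (f \o v) w | f in [set f : A -> B | isomorphism f]] <=
    s%:E)%E.
  move=> lt_s.
  have [a [b [ab_vw a_dense b_dense ab_lt]]] :=
    back_and_forth_sequences step_le lt_s A_sep B_sep.
  have ab_zero n : (k <= n)%N ->
      (bf_zero Om (fun i : 'I_n => a i) (fun i : 'I_n => b i) <= s%:E)%E.
    by move=> /ab_lt/ltW; exact: le_trans.
  have vE : v = (fun i : 'I_k => a i) by apply/funext => i; case: (ab_vw i).
  have wE : w = (fun i : 'I_k => b i) by apply/funext => i; case: (ab_vw i).
  have [f f_iso] := sequences_isomorphism Om_univ ab_zero a_dense b_dense.
  by rewrite vE wE; apply: le_trans; apply: ereal_inf_lbound; exists f.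
(* A finite value is approached by reals [s] from above. At [-oo], every real would bound the
   infimum, which must then be [-oo] too. *)
case: (bf_infty Om v w) inf_le => [x| |] inf_le; last 2 first.
- exact: leey.
- move: inf_le; case: (ereal_inf _) => [x| |//] inf_le.
    by have := inf_le (x - 1) (ltNyr _); rewrite lee_fin lerDl oppr_ge0 ler10.
  by have := inf_le 0 (ltNyr _).
by apply/lee_addgt0Pr => e e0; apply: inf_le; rewrite lte_fin ltrDl.
Qed.

Theorem theorem5p5 (R : realType) (L : signature R)
    (Om : {ptws nat -> R} -> \bar R) (A B : structure L)
    (k : nat) (v : 'I_k -> A) (w : 'I_k -> B) :
  countable_signature L ->
  universal_weak_modulus L Om ->
  separable A -> separable B ->
  [/\ bf_infty Om v w =
        ereal_inf [set tuple_dist Om (f \o v) w | f in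
                     [set f : A -> B | isomorphism f]],
      isomorphic A B -> bf_infty Om (@tnil A) (@tnil B) = 0%E &
      ~ isomorphic A B -> bf_infty Om (@tnil A) (@tnil B) = +oo%E].
Proof.
move=> _ Om_univ A_sep B_sep.
have inftyE n a b : bf_infty Om a b = ereal_inf
    [set tuple_dist Om (f \o a : 'I_n -> B) b | f in
       [set f : A -> B | isomorphism f]].
  exact: bf_inftyE.
split=> [|[f f_iso]|niso]; first exact: inftyE.
(* At empty tuples each isomorphism contributes [Om 0 = 0], so the infimum ranges over a singleton
   or over the empty set. *)
- have dist0 g : tuple_dist Om (g \o @tnil A) (@tnil B) = 0%E.
    have [[Om0 _ _ _ _] _ _ _ _] := Om_univ.
    rewrite /tuple_dist /trunc -[RHS]Om0.
    by congr Om; apply/funext => i; rewrite zero_extend_ge.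
  rewrite inftyE (_ : image _ _ = [set 0%E]) ?ereal_inf1//.
  by apply/seteqP; split=> [x [g _ <-]|x ->]; [exact: dist0|exists f].
- rewrite inftyE (_ : image _ _ = set0) ?ereal_inf0//.
  by apply/seteqP; split=> // x [f f_iso _]; apply: niso; exists f.
Qed.
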